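(* In the two-firm negotiation game described in the context, suppose $\beta_1\le\beta_2$. Then the alternating iterative procedure $S_0:=\emptyset$, $T_n:=\Gamma_2(S_n)$, $S_{n+1}:=\Gamma_1(T_n)$ ($n=0,1,2,\dots$) terminates after one iteration (i.e. $S_n=S_0$ and $T_n=T_0$ for all $n$) and gives a sharp inter-personal equilibrium. That is, with $S_\infty:=\bigcup_nS_n$ and $T_\infty:=\bigcap_nT_n$, $$(S_\infty,T_\infty)=(S_0,T_0)=(\emptyset,(0,y_2^*]\cap\mathbb{X})\in\widehat{\mathcal{E}}.$$
   Context: Two-firm negotiation game. $\mathbb{Z}_+=\{0,1,2,\dots\}$, $\mathbb{N}=\{1,2,\dots\}$. Fix $u>1$ and $p\in(0,1)$ with $p\ge\frac1{u+1}$. $X=(X_t)_{t\in\mathbb{Z}_+}$ is the time-homogeneous Markov chain on $\mathbb{X}=\{u^j:j=0,\pm1,\pm2,\dots\}$ with $\mathbb{P}_x(X_1/x=u)=p$ and $\mathbb{P}_x(X_1/x=1/u)=1-p$ for all $x\in\mathbb{X}$ (so $X$ is a submartingale); $\mathbb{P}_x$ is the law of $X$ started at $x$, $\mathbb{E}_x$ its expectation, $\mathcal{B}=2^{\mathbb{X}}$, and $\mathcal{T}$ is the set of stopping times of the filtration generated by $X$ (allowed to take the value $+\infty$). Fix $R>0$, $N\in(R/2,R)$ and $K:=R-N\in(0,R/2)$. For $i\in\{1,2\}$ and $x\in\mathbb{X}$, $f_i(x)=(K-x)^+$, $g_i(x)=N$, and $h_i:\mathbb{X}\to\mathbb{R}_+$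 is any function with $f_i\le h_i\le g_i$; the discount functions are $\delta_i(t)=\frac1{1+\beta_it}$ with constants $\beta_i>0$. For $\tau,\sigma\in\mathcal{T}$, $F_i(\tau,\sigma):=\delta_i(\tau)f_i(X_\tau)1_{\{\tau<\sigma\}}+\delta_i(\sigma)g_i(X_\sigma)1_{\{\tau>\sigma\}}+\delta_i(\tau)h_i(X_\tau)1_{\{\tau=\sigma\}}$, with $F_i(\tau,\sigma):=\limsup_{t\to\infty}\delta_i(t)h_i(X_t)$ on $\{\tau=\sigma=+\infty\}$, and $J_i(x,\tau,\sigma):=\mathbb{E}_x[F_i(\tau,\sigma)]$ ($\tau$ is Player/Firm $i$'s stopping time, $\sigma$ the other's). For $S\in\mathcal{B}$, $\rho_S:=\inf\{t\ge0:X_t\in S\}$ and $\rho_S^+:=\inf\{t>0:X_t\in S\}$ ($\inf\emptyset=\infty$). Equilibria. For $S,T\in\mathcal{B}$ let $\Theta_i^T(S):=\{x\in S: J_i(x,0,\rho_T)\ge J_i(x,\rho_S^+,\rho_T)\}\cup\{x\notin S: J_i(x,0,\rho_T)>J_i(x,\rho_S^+,\rho_T)\}$ and $\mathcal{E}_i^T:=\{S\in\mathcal{B}:\Theta_i^T(S)=S\}$ (intra-personal equilibria of Player $i$ with respect to $T$). For $S\in\mathcal{E}_i^T$ let $U_i^T(x,S):=\max\{J_i(x,0,\rho_T),J_i(x,\rho_S^+,\rho_T)\}$; $\widehat{\mathcal{E}}_i^T$ is the set of $S\in\mathcal{E}_i^T$ with $U_i^T(x,S)\ge U_i^T(x,R')$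 for all $R'\in\mathcal{E}_i^T$, $x\in\mathbb{X}$. A pair $(S,T)$ is a sharp inter-personal equilibrium if $S\in\widehat{\mathcal{E}}_1^T$ and $T\in\widehat{\mathcal{E}}_2^S$; $\widehat{\mathcal{E}}$ is the set of these. The maps $\Gamma_i$. Let $V_i^T(x,S):=\sup\{\mathbb{E}_x[F_i(\tau,\rho_T)]:\tau\in\mathcal{T},\,1\le\tau\le\rho_S^+\}$ and $\Phi_i^T(S):=S\cup\{x\notin S:J_i(x,0,\rho_T)>V_i^T(x,S)\}$. Put $S_i^1(T):=\Phi_i^T(\emptyset)$, $S_i^n(T):=\Phi_i^T(S_i^{n-1}(T))$ for $n\ge2$, and $\Gamma_i(T):=\bigcup_{n\in\mathbb{N}}S_i^n(T)$. Threshold. Let $Y$ be a random walk on the integers with $P(Y_{t+1}-Y_t=1)=p$, $P(Y_{t+1}-Y_t=-1)=1-p$, let $\xi:=\inf\{t\ge0:Y_t=0\}$, and $\alpha_i^1:=E\big[\frac1{1+\beta_i\xi}\,\big|\,Y_0=1\big]$ (the integrand being $0$ when $\xi=\infty$). Then $y_i^*:=\min\big\{\big[\frac{1-\alpha_i^1}{u-\alpha_i^1}K,\infty\big)\cap\mathbb{X}\big\}$. *)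

(* Defs.v *)
From mathcomp Require Import all_boot all_order all_algebra.
From mathcomp Require Import all_classical all_reals all_analysis.

Set Implicit Arguments.
Unset Strict Implicit.
Unset Printing Implicit Defensive.

Import Order.TTheory GRing.Theory Num.Theory.
Local Open Scope classical_set_scope.
Local Open Scope ring_scope.

(* Times in {0, 1, 2, ...} U {+oo}: [None] is +oo. *)
Definition etime := option nat.

Definition tlt (a b : etime) : bool :=
  match a, b with
  | Some t, Some s => (t < s)%N
  | Some _, None => true
  | None, _ => false
  end.

Definition tle (a b : etime) : bool := ~~ tlt b a.

(* inf A, with inf set0 = +oo *)
Definition first_time (A : set nat) : etime :=
  match pselect (exists t, `[< A t >]) with
  | left exA => Some (ex_minn exA)
  | right _ => None
  end.

Definition hit (E Omega : Type) (X : nat -> Omega -> E) (S : set E)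
    (w : Omega) : etime :=
  first_time [set t | S (X t w)].

Definition hit_pos (E Omega : Type) (X : nat -> Omega -> E) (S : set E)
    (w : Omega) : etime :=
  first_time [set t | (0 < t)%N /\ S (X t w)].

Definition natural_filtration (E Omega : Type) (X : nat -> Omega -> E)
    (t : nat) : set (set Omega) :=
  <<s [set B | exists k (A : set E), (k <= t)%N /\ B = X k @^-1` A] >>.

Definition stopping_time (E Omega : Type) (X : nat -> Omega -> E)
    (tau : Omega -> etime) : Prop :=
  forall t : nat, natural_filtration X t [set w | tle (tau w) (Some t)].

(* Time-homogeneous Markov chain on a countable state space E (with the discrete
   sigma-algebra) and transition probabilities q; the initial law is arbitrary.
   The second clause is the Markov property
     P(X_{n+1} = s_{n+1} | X_0 = s_0, ..., X_n = s_n) = q s_n s_{n+1},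
   multiplied by the probability of the conditioning event. *)
Definition markov_chain (R : realType) (E : Type) (q : E -> E -> R)
    (d : measure_display) (Omega : measurableType d) (P : probability Omega R)
    (X : nat -> Omega -> E) : Prop :=
  (forall t (A : set E), measurable (X t @^-1` A)) /\
  (forall (n : nat) (s : nat -> E),
    P [set w | forall k, (k <= n.+1)%N -> X k w = s k] =
    (P [set w | forall k, (k <= n)%N -> X k w = s k] * (q (s n) (s n.+1))%:E)%E).

(* P x is the law of the chain started at x. *)
Definition markov_family (R : realType) (E : Type) (q : E -> E -> R)
    (d : measure_display) (Omega : measurableType d)
    (P : E -> probability Omega R) (X : nat -> Omega -> E) : Prop :=
  forall x, markov_chain q (P x) X /\ P x [set w | X 0%N w = x] = 1%E.

Record player (R : realType) (E : Type) := Player {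
  discount : nat -> R;
  payoff_first : E -> R;   (* f: the player stops strictly first *)
  payoff_second : E -> R;  (* g: the opponent stops strictly first *)
  payoff_tie : E -> R      (* h: both stop simultaneously *)
}.

Section game.
Context (R : realType) (E : Type) (d : measure_display)
  (Omega : measurableType d) (P : E -> probability Omega R)
  (X : nat -> Omega -> E) (i : player R E).

Definition payoff (tau sigma : Omega -> etime) (w : Omega) : \bar R :=
  match tau w, sigma w with
  | Some t, Some s =>
      if (t < s)%N then (discount i t * payoff_first i (X t w))%:E
      else if (s < t)%N then (discount i s * payoff_second i (X s w))%:E
      else (discount i t * payoff_tie i (X t w))%:E
  | Some t, None => (discount i t * payoff_first i (X t w))%:E
  | None, Some s => (discount i s * payoff_second i (X s w))%:E
  | None, None => limn_esup (fun t => (discount i t * payoff_tie i (X t w))%:E)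
  end.

Definition J (x : E) (tau sigma : Omega -> etime) : \bar R :=
  (\int[P x]_w payoff tau sigma w)%E.

Definition J_stop (T : set E) (x : E) : \bar R :=
  J x (fun=> Some 0%N) (hit X T).

Definition J_continue (T S : set E) (x : E) : \bar R :=
  J x (hit_pos X S) (hit X T).

Definition Theta (T S : set E) : set E :=
  [set x | S x /\ (J_continue T S x <= J_stop T x)%E] `|`
  [set x | ~ S x /\ (J_continue T S x < J_stop T x)%E].

Definition intra_equilibrium (T : set E) : set (set E) :=
  [set S | Theta T S = S].

Definition U (T : set E) (x : E) (S : set E) : \bar R :=
  maxe (J_stop T x) (J_continue T S x).

Definition optimal_intra_equilibrium (T : set E) : set (set E) :=
  [set S | intra_equilibrium T S /\
    forall S', intra_equilibrium T S' -> forall x, (U T x S' <= U T x S)%E].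

Definition V (T : set E) (x : E) (S : set E) : \bar R :=
  ereal_sup [set J x tau (hit X T) | tau in
    [set tau | stopping_time X tau /\
      forall w, tle (Some 1%N) (tau w) && tle (tau w) (hit_pos X S w)]].

Definition Phi (T S : set E) : set E :=
  S `|` [set x | ~ S x /\ (V T x S < J_stop T x)%E].

(* iter n.+1 (Phi T) set0 is S^{n+1}(T), so the union is over S^1, S^2, ... *)
Definition Gamma (T : set E) : set E :=
  \bigcup_n iter n.+1 (Phi T) set0.

End game.

Definition sharp_equilibrium (R : realType) (E : Type) (d : measure_display)
    (Omega : measurableType d) (P : E -> probability Omega R)
    (X : nat -> Omega -> E) (i1 i2 : player R E) : set (set E * set E) :=
  [set ST | optimal_intra_equilibrium P X i1 ST.2 ST.1 /\
            optimal_intra_equilibrium P X i2 ST.1 ST.2].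

Fixpoint S_iter (R : realType) (E : Type) (d : measure_display)
    (Omega : measurableType d) (P : E -> probability Omega R)
    (X : nat -> Omega -> E) (i1 i2 : player R E) (n : nat) : set E :=
  if n is m.+1 then Gamma P X i1 (Gamma P X i2 (S_iter P X i1 i2 m)) else set0.

Definition T_iter (R : realType) (E : Type) (d : measure_display)
    (Omega : measurableType d) (P : E -> probability Omega R)
    (X : nat -> Omega -> E) (i1 i2 : player R E) (n : nat) : set E :=
  Gamma P X i2 (S_iter P X i1 i2 n).

Definition powers (R : realType) (u : R) : set R :=
  [set x | exists j : int, x = u ^ j].

Definition state (R : realType) (u : R) : Type := set_type (powers u).

Definition state_step (R : realType) (u p : R) (x y : state u) : R :=
  if set_val y / set_val x == u then p
  else if set_val y / set_val x == u^-1 then 1 - p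
  else 0.

Definition walk_step (R : realType) (p : R) (a b : int) : R :=
  if b - a == 1 then p else if b - a == - 1 then 1 - p else 0.

Definition hyperbolic (R : realType) (beta : R) (t : nat) : R :=
  (1 + beta * t%:R)^-1.

Definition firm (R : realType) (u K N beta : R) (h : state u -> R) :
    player R (state u) :=
  {| discount := hyperbolic beta;
     payoff_first := fun x => Num.max (K - set_val x) 0;
     payoff_second := fun=> N;
     payoff_tie := h |}.

(* E[1 / (1 + beta xi) | Y_0 = 1], xi being the first time t >= 0 at which
   Y_t = 0; conditioning is on an event, which must have positive probability. *)
Definition alpha (R : realType) (d : measure_display) (Omega : measurableType d)
    (Q : probability Omega R) (Y : nat -> Omega -> int) (beta : R) : R :=
  let Y0_is_1 := [set w | Y 0%N w = 1] in
  let disc w :=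
    if hit Y [set 0] w is Some xi then hyperbolic beta xi else 0 in
  fine (\int[Q]_(w in Y0_is_1) (disc w)%:E)%E / fine (Q Y0_is_1).

(* The value is 0 when A has no least element. *)
Definition minimum (R : realType) (A : set R) : R :=
  xget 0 (A `&` lbound A).

Definition threshold (R : realType) (u K a : R) : R :=
  minimum ([set x | (1 - a) / (u - a) * K <= x] `&` powers u).

(* Main.v *)
Require Import Defs.
From mathcomp Require Import all_boot all_order all_algebra.
From mathcomp Require Import all_classical all_reals all_analysis.
From mathcomp Require Import measurable_realfun.
From mathcomp Require Import zify ring lra.

(** Write prices as powers of u and follow the exponent of the price, its
    height: it is a nearest-neighbour walk on the integers, and ystar2 is u ^ j
    for some height j. The basic quantity is A(t, k), the mean of
    1 / (1 + b (t + xi)) where xi is the time the walk takes to go from k to 0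
    ([hit_value]); the number alpha is A(0, 1). Hyperbolic discounting shows
    decreasing impatience, disc s * disc t <= disc (s + t), and A inherits it:
    disc t * A(0, k) <= A(t, k) ([hit_value_delay]) and
    A(0, k) * A(0, 1) <= A(0, k + 1) ([hit_value_step]). Every expected payoff is
    estimated by optional stopping of a process v(t, height at time t) that is a
    supermartingale or a submartingale as long as the game is on
    ([reward_le_supermartingale], [reward_ge_submartingale]).

    Firm 2 against an opponent who never concedes. The threshold is chosen so
    that waiting for the price to drop by one step is at least as good as
    stopping exactly when the price lies above ystar2. Hence no price above
    ystar2 enters the iterates of Phi ([lone_iter_sub]). Conversely, suppose that
    an iterate contains all heights up to k, with k < j. The advantage of
    stopping at a height l > k over waiting for the barrier k, that is
    put l - put k * A(0, l - k), is positive at l = k + 1 and is not positive for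
    large l, so it has a positive maximum D, reached at some l. A plan that
    starts at l, is delayed by at least one period and stops no later than at the
    barrier earns at most put k * A(0, l - k) + disc 1 * D, which is less than
    put l, because compared with waiting for the barrier it gains at most the
    advantage D, and at least one period later. So l enters the next iterate
    ([lone_Phi_progress]). As the price is a submartingale, the payoff K - x is a
    supermartingale, so all prices below an element of an iterate enter the
    following one ([lone_Phi_below]), in particular k + 1. Therefore Gamma of the
    empty set is the set of all prices up to ystar2 ([lone_Gamma]). An
    equilibrium always contains Gamma, and among the sets that contain it none
    gives a larger value than Gamma itself, again by decreasing impatience
    ([lone_optimal]).

    Firm 1 against an opponent who concedes at or below ystar2. Above ystar2,
    put k <= put j * A2(0, k - j) <= N * A1(0, k - j), since put j <= K <= N and
    the more patient firm 1 has the larger values A1. Stopping is therefore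
    dominated by waiting for the concession, worth N * A1(0, k - j), at all times
    ([J_le_surrender]). So Gamma of that set is empty, the empty set is an optimal
    equilibrium of firm 1, and the alternating procedure is stationary. *)

Import Order.TTheory GRing.Theory Num.Theory.
Import numFieldNormedType.Exports.
Local Open Scope classical_set_scope.
Local Open Scope ring_scope.

Set Implicit Arguments.
Unset Strict Implicit.
Unset Printing Implicit Defensive.

(** * Hyperbolic discounting *)

Section hyperbolic_discount.
Context (R : realType) (b : R) (b_gt0 : 0 < b).
Local Notation disc := (hyperbolic b).

Lemma hyperbolic_denom_gt0 t : 0 < 1 + b * t%:R.
Proof. by rewrite ltr_wpDr// mulr_ge0// ltW. Qed.

Lemma hyperbolic_gt0 t : 0 < disc t.
Proof. by rewrite invr_gt0 hyperbolic_denom_gt0. Qed.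

Lemma hyperbolic_ge0 t : 0 <= disc t.
Proof. exact/ltW/hyperbolic_gt0. Qed.

Lemma hyperbolic0 : disc 0 = 1.
Proof. by rewrite /hyperbolic mulr0 addr0 invr1. Qed.

Lemma hyperbolic_antitone s t : (s <= t)%N -> disc t <= disc s.
Proof.
move=> st; rewrite lef_pV2 ?posrE ?hyperbolic_denom_gt0//.
by rewrite lerD2l ler_pM2l// ler_nat.
Qed.

Lemma hyperbolic1_lt1 : disc 1 < 1.
Proof. by rewrite invf_lt1 ?hyperbolic_denom_gt0// mulr1 ltrDl. Qed.

(** Decreasing impatience: a delay by t costs relatively less when it comes
    after a delay by s. *)
Lemma hyperbolicD s t : disc s * disc t <= disc (s + t).
Proof.
rewrite /hyperbolic -invfM lef_pV2 ?posrE ?mulr_gt0 ?hyperbolic_denom_gt0//.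
rewrite natrD; have : 0 <= b * b * s%:R * t%:R :> R by rewrite !mulr_ge0// ltW.
lra.
Qed.

Lemma hyperbolic_cvg0 : disc t @[t --> \oo] --> (0 : R).
Proof.
have den_cvg : (1 + b * t%:R : R) @[t --> \oo] --> +oo.
  have le_den : \forall t \near \oo, b * t%:R <= 1 + b * t%:R :> R.
    by apply: nearW => t; rewrite lerDr.
  apply: (ger_cvgy le_den).
  exact: (cvg_comp _ _ cvgr_idn (gt0_cvgMry b_gt0 (@cvg_id _ _))).
apply: (iffRL (gtr0_cvgV0 _) den_cvg).
by apply: nearW => n; exact: hyperbolic_denom_gt0.
Qed.

End hyperbolic_discount.

Lemma hyperbolic_le (R : realType) (b c : R) t : 0 < b -> b <= c ->
  hyperbolic c t <= hyperbolic b t.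
Proof.
move=> b0 bc; have c0 := lt_le_trans b0 bc.
rewrite lef_pV2 ?posrE ?hyperbolic_denom_gt0//.
by rewrite lerD2l ler_wpM2r.
Qed.

(** * Discounted passage of the walk to zero *)

Section hitting_value.
Context (R : realType) (p : R) (p_ge0 : 0 <= p) (p_le1 : p <= 1).
Implicit Types (n t s : nat) (k : int).

(** The mean of disc (t + xi) on the event xi <= n, where xi is the passage time
    of the walk from k to 0, computed by conditioning on the first step. *)
Fixpoint hit_within (b : R) n t k : R :=
  if k == 0 then hyperbolic b t else
  if n is m.+1 then
    p * hit_within b m t.+1 (k + 1) + (1 - p) * hit_within b m t.+1 (k - 1)
  else 0.

(** Defined on negative heights too, where the walk reaches 0 from below; this
    keeps the one-step equation valid at every height but 0. *)
Definition hit_value (b : R) t k : R := limn (fun n => hit_within b n t k).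

Section fixed_rate.
Context (b : R) (b_gt0 : 0 < b).
Local Notation disc := (hyperbolic b).
Local Notation A_ := (hit_within b).
Local Notation A := (hit_value b).

Let q_ge0 : 0 <= 1 - p. Proof. by rewrite subr_ge0. Qed.

Lemma hit_within0 n t : A_ n t 0 = disc t. Proof. by case: n. Qed.

Lemma hit_within_recr n t k : k != 0 ->
  A_ n.+1 t k = p * A_ n t.+1 (k + 1) + (1 - p) * A_ n t.+1 (k - 1).
Proof. by move=> /= /negbTE ->. Qed.

Lemma hit_within_bounds n t k : 0 <= A_ n t k <= disc t.
Proof.
elim: n t k => [|n IH] t k; have [->|k0] := eqVneq k 0;
  rewrite ?hit_within0 ?lexx ?hyperbolic_ge0//.
  by rewrite /= (negbTE k0) lexx hyperbolic_ge0.
rewrite hit_within_recr//; have /andP[a0 a1] := IH t.+1 (k + 1).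
have /andP[c0 c1] := IH t.+1 (k - 1).
have dd : disc t.+1 <= disc t by exact: hyperbolic_antitone.
apply/andP; split; first by rewrite addr_ge0// mulr_ge0.
apply: (@le_trans _ _ (p * disc t + (1 - p) * disc t)); last by lra.
by rewrite lerD// ler_wpM2l//; [exact: le_trans dd|exact: le_trans dd].
Qed.

Lemma hit_withinS n t k : A_ n t k <= A_ n.+1 t k.
Proof.
elim: n t k => [|n IH] t k; have [->|k0] := eqVneq k 0; rewrite ?hit_within0//.
  by rewrite {1}/hit_within (negbTE k0); case/andP: (hit_within_bounds 1 t k).
by rewrite [leLHS]hit_within_recr// [leRHS]hit_within_recr// lerD// ler_wpM2l.
Qed.

Lemma is_cvg_hit_within t k : cvgn (fun n => A_ n t k).
Proof.
apply: nondecreasing_is_cvgn.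
  by apply/nondecreasing_seqP => n; exact: hit_withinS.
exists (disc t) => _ [n _ <-]; by case/andP: (hit_within_bounds n t k).
Qed.

Lemma hit_value0 t : A t 0 = disc t.
Proof.
rewrite /hit_value (_ : (fun n => _) = fun=> disc t) ?lim_cst//.
by apply/funext => n; rewrite hit_within0.
Qed.

Lemma hit_value_rec t k : k != 0 ->
  A t k = p * A t.+1 (k + 1) + (1 - p) * A t.+1 (k - 1).
Proof.
move=> k0; apply/cvg_lim => //; rewrite -(cvg_shiftn 1)/=.
under eq_fun do rewrite addn1 hit_within_recr//.
by apply: cvgD; apply: cvgMr; exact: is_cvg_hit_within.
Qed.

Lemma hit_value_bounds t k : 0 <= A t k <= disc t.
Proof.
apply/andP; split.
  apply: limr_ge; first exact: is_cvg_hit_within.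
  by apply: nearW => n; case/andP: (hit_within_bounds n t k).
apply: limr_le; first exact: is_cvg_hit_within.
by apply: nearW => n; case/andP: (hit_within_bounds n t k).
Qed.

Lemma hit_value_ge0 t k : 0 <= A t k.
Proof. by case/andP: (hit_value_bounds t k). Qed.

Lemma hit_value_le t k : A t k <= disc t.
Proof. by case/andP: (hit_value_bounds t k). Qed.

Lemma hit_value_lt1 : A 0 1 < 1.
Proof.
rewrite hit_value_rec// subrr hit_value0 addrC.
apply: le_lt_trans (hyperbolic1_lt1 b_gt0).
apply: (@le_trans _ _ ((1 - p) * disc 1 + p * disc 1)); last by lra.
by rewrite lerD2l ler_wpM2l// hit_value_le.
Qed.

(** The passage time after a delay t is discounted by disc (t + xi), which is at
    least disc t * disc xi. *)
Lemma hit_value_delay t k : disc t * A 0 k <= A t k.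
Proof.
have fin n s : disc t * A_ n s k <= A_ n (t + s) k.
  elim: n s k => [|n IH] s k'; have [->|k0] := eqVneq k' 0;
    rewrite ?hit_within0 ?hyperbolicD//.
    by rewrite /= (negbTE k0) mulr0.
  rewrite !hit_within_recr// mulrDr !(mulrCA (disc t)) -addnS.
  by rewrite lerD// ler_wpM2l.
have c : disc t * A_ n 0 k @[n --> \oo] --> disc t * A 0 k.
  by apply: cvgMr; exact: is_cvg_hit_within.
rewrite -(cvg_lim _ c)//; apply: ler_lim; [exact: cvgP c|exact: is_cvg_hit_within|].
by apply: nearW => n; rewrite -{2}[t]addn0; exact: fin.
Qed.

(** A passage from k + 1 to 0 is a passage to 1 followed by an independent one
    from 1 to 0, and disc (s + t) >= disc s * disc t. In analytic form: the
    difference D(t, k) = A(t, k + 1) - A(t, k) A(0, 1) is nonnegative at k = 0 by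
    [hit_value_delay], satisfies the one-step equation for k >= 1, and is bounded
    below by minus the discount factor. Iterating the equation n times pushes
    that lower bound to - disc (t + n), which vanishes. *)
Lemma hit_value_step k : 0 <= k -> A 0 k * A 0 1 <= A 0 (k + 1).
Proof.
pose D t j := A t (j + 1) - A t j * A 0 1.
have D_ge n t j : 0 <= j -> - disc (t + n) <= D t j.
  elim: n t j => [|n IH] t j j0.
    rewrite addn0 /D.
    have := hit_value_le t j; have := hit_value_le 0 1; have := hit_value_ge0 t j.
    have := hit_value_ge0 t (j + 1); have := hit_value_ge0 0 1.
    rewrite hyperbolic0; nra.
  have [->|jn0] := eqVneq j 0.
    rewrite /D add0r hit_value0; have := hit_value_delay t 1.
    have := hyperbolic_ge0 b_gt0 (t + n.+1); lra.
  have j1 : 1 <= j by lia.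
  rewrite /D [A t (j + 1)]hit_value_rec; last by lia.
  rewrite [A t j]hit_value_rec//.
  have h1 := IH t.+1 (j + 1) ltac:(lia); have h2 := IH t.+1 (j - 1) ltac:(lia).
  rewrite /D in h1 h2; rewrite addnS -addSn.
  rewrite subrK in h2; rewrite addrK.
  have := ler_wpM2l p_ge0 h1; have := ler_wpM2l q_ge0 h2; lra.
move=> k0; rewrite -subr_ge0 -[A _ _ - _]/(D 0 k).
have c : - disc t @[t --> \oo] --> (0 : R).
  by rewrite -oppr0; apply: cvgN; exact: hyperbolic_cvg0.
rewrite -(cvg_lim _ c)//; apply: limr_le; first exact: cvgP c.
by apply: nearW => n; exact: (D_ge n 0 k k0).
Qed.

End fixed_rate.

Lemma hit_value_le_rate (b c : R) t k : 0 < b -> b <= c ->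
  hit_value c t k <= hit_value b t k.
Proof.
move=> b0 bc; have c0 := lt_le_trans b0 bc.
apply: ler_lim; [exact: is_cvg_hit_within|exact: is_cvg_hit_within|].
apply: nearW => n; elim: n t k => [|n IH] t k; have [->|k0] := eqVneq k 0;
  rewrite ?hit_within0 ?hyperbolic_le//.
  by rewrite /= (negbTE k0).
by rewrite !hit_within_recr// lerD// ler_wpM2l// subr_ge0.
Qed.

End hitting_value.

(** * Optional stopping for the walk *)

(** The integral of a nonnegative function is the supremum of the integrals of
    the simple functions below it, so it is monotone on arbitrary nonnegative
    functions. It reduces payoffs, which involve two stopping times, to rewards
    at a single one, for which measurability is proved below. *)
Lemma le_integral_nonneg (d : measure_display) (T : measurableType d)
    (R : realType) (mu : measure T R) (G H : T -> \bar R) :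
  (forall w, 0 <= G w)%E -> (forall w, G w <= H w)%E ->
  (\int[mu]_w G w <= \int[mu]_w H w)%E.
Proof.
move=> G0 GH; have H0 w : (0 <= H w)%E by exact: le_trans (GH w).
rewrite !ge0_integralTE//; apply: le_ereal_sup => _ [f fG <-].
by exists f => // w; exact: le_trans (GH w).
Qed.

Section walk.
Context (R : realType) (p : R) (p_ge0 : 0 <= p) (p_le1 : p <= 1).
Context (d : measure_display) (Omega : measurableType d)
  (P : probability Omega R) (Z : nat -> Omega -> int)
  (Z_walk : markov_chain (walk_step p) P Z).
Implicit Types (t n : nat) (B : set Omega) (tau : Omega -> etime).

(** Events determined by the walk up to time n. Saturation for the values of the
    walk replaces membership in the generated sigma-algebra: it is what lets an
    event be cut into path cylinders. *)
Definition known n B : Prop :=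
  measurable B /\
  forall w w', (forall k, (k <= n)%N -> Z k w = Z k w') -> B w -> B w'.

Lemma known_measurable n B : known n B -> measurable B.
Proof. by case. Qed.

Lemma known_walk k n (S : set int) : (k <= n)%N -> known n (Z k @^-1` S).
Proof.
move=> kn; split; first exact: Z_walk.1.
by move=> w w' /(_ k kn) eqZ; rewrite /preimage/= eqZ.
Qed.

Lemma known_set0 n : known n set0.
Proof. by split; [exact: measurable0|]. Qed.

Lemma known_setC n B : known n B -> known n (~` B).
Proof.
move=> [mB cB]; split; first exact: measurableC.
by move=> w w' eqZ Bw Bw'; apply: Bw; apply: cB Bw' => k kn; rewrite eqZ.
Qed.

Lemma known_bigcup n (F : nat -> set Omega) :
  (forall i, known n (F i)) -> known n (\bigcup_i F i).
Proof.
move=> kF; split; first by apply: bigcup_measurable => i _; case: (kF i).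
by move=> w w' eqZ [i _ Fw]; exists i => //; exact: (kF i).2 eqZ Fw.
Qed.

Lemma known_setI n B C : known n B -> known n C -> known n (B `&` C).
Proof.
move=> [mB cB] [mC cC]; split; first exact: measurableI.
by move=> w w' eqZ [Bw Cw]; split; [exact: cB eqZ Bw|exact: cC eqZ Cw].
Qed.

Lemma known_le m n B : (m <= n)%N -> known m B -> known n B.
Proof.
move=> mn [mB cB]; split=> // w w' eqZ.
by apply: cB => k km; apply: eqZ; exact: leq_trans mn.
Qed.

Lemma known_sigma_algebra n : sigma_algebra [set: Omega] (known n).
Proof.
split; [exact: known_set0| |exact: known_bigcup].
by move=> B kB; rewrite setTD; exact: known_setC.
Qed.

Lemma measurable_fun_walk t (phi : int -> R) B : measurable B ->
  measurable_fun B (fun w => (phi (Z t w))%:E).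
Proof.
move=> mB _ Y _; apply: measurableI => //.
exact: (Z_walk.1 t ((fun k => (phi k)%:E) @^-1` Y)).
Qed.

Definition cylinder n (s : nat -> int) : set Omega :=
  [set w | forall k, (k <= n)%N -> Z k w = s k].

Lemma measurable_cylinder n s : measurable (cylinder n s).
Proof.
rewrite (_ : cylinder n s = \bigcap_(k in `I_n.+1) Z k @^-1` [set s k]).
  by apply: bigcap_measurable => [|k _]; [exists 0%N|exact: Z_walk.1].
by apply/seteqP; split=> [w cw k kn|w cw k kn]; exact: cw.
Qed.

Lemma cylinder_step n s j :
  P (cylinder n s `&` Z n.+1 @^-1` [set j]) =
  (P (cylinder n s) * (walk_step p (s n) j)%:E)%E.
Proof.
pose s' k := if (k <= n)%N then s k else j.
have -> : cylinder n s = [set w | forall k, (k <= n)%N -> Z k w = s' k].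
  by apply/seteqP; split=> w cw k kn; have := cw k kn; rewrite /s' kn.
have -> : [set w | forall k, (k <= n)%N -> Z k w = s' k] `&`
    Z n.+1 @^-1` [set j] = [set w | forall k, (k <= n.+1)%N -> Z k w = s' k].
  apply/seteqP; split=> [w [cw zj] k|w cw].
    rewrite leq_eqVlt => /predU1P[->|]; last exact: cw.
    by rewrite /s' ltnn.
  split; first by move=> k kn; apply: cw; exact: leqW.
  by have := cw n.+1 (leqnn _); rewrite /s' ltnn.
by rewrite Z_walk.2 /s' leqnn ltnn.
Qed.

(** On a path cylinder the next position is one of the two neighbours up to a
    null event, because the two transition probabilities add up to 1. *)
Lemma cylinder_integral_step n s (phi : int -> R) : (forall k, 0 <= phi k) ->
  (\int[P]_(w in cylinder n s) (phi (Z n.+1 w))%:E =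
   \int[P]_(w in cylinder n s)
     (p * phi (Z n w + 1) + (1 - p) * phi (Z n w - 1))%:E)%E.
Proof.
move=> phi0; set C := cylinder n s; set a := s n.
have mC : measurable C := measurable_cylinder n s.
pose up := C `&` Z n.+1 @^-1` [set a + 1].
pose dn := C `&` Z n.+1 @^-1` [set a - 1].
pose rest := C `\` (up `|` dn).
have mup : measurable up by apply: measurableI => //; exact: Z_walk.1.
have mdn : measurable dn by apply: measurableI => //; exact: Z_walk.1.
have mrest : measurable rest by apply: measurableD => //; exact: measurableU.
have dis1 : [disjoint up & dn].
  apply/disj_setPS => w [[_ /= e1] [_ /= e2]]; move: e1; rewrite e2; lia.
have dis2 : [disjoint up `|` dn & rest].
  by apply/disj_setPS => w [h [_]].
have CE : C = (up `|` dn) `|` rest.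
  by rewrite /rest setDUK// => w [[]|[]].
have Pup : P up = (P C * p%:E)%E.
  by rewrite /up cylinder_step /walk_step (_ : a + 1 - _ = 1) ?eqxx//; lia.
have Pdn : P dn = (P C * (1 - p)%:E)%E.
  rewrite /dn cylinder_step /walk_step (_ : a - 1 - _ = -1) ?eqxx//; lia.
have fC : P C \is a fin_num := fin_num_measure P C mC.
have Prest : P rest = 0%E.
  have : P C = (P up + P dn + P rest)%E.
    rewrite [in LHS]CE measureU//; [|exact: measurableU|]; last first.
      by apply/disj_set2P.
    by rewrite measureU//; apply/disj_set2P.
  have -> : (P up + P dn = P C)%E.
    by rewrite Pup Pdn -(fineK fC) -!EFinM -EFinD; congr EFin; ring.
  have fr : P rest \is a fin_num := fin_num_measure P rest mrest.
  by rewrite -(fineK fC) -(fineK fr) -EFinD => -[?]; congr EFin; lra.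
have intc c B : measurable B ->
    (forall w, B w -> phi (Z n.+1 w) = c) ->
    (\int[P]_(w in B) (phi (Z n.+1 w))%:E = c%:E * P B)%E.
  move=> mB hB; rewrite -integral_cst//; apply: eq_integral => w.
  by rewrite inE => /hB ->.
rewrite [in LHS]CE ge0_integral_setU//=; [|exact: measurableU|
  by apply: measurable_fun_walk; do 2 (apply: measurableU => //)|
  by move=> w _; rewrite lee_fin].
rewrite ge0_integral_setU//=; [|
  by apply: measurable_fun_walk; apply: measurableU|
  by move=> w _; rewrite lee_fin].
rewrite (null_set_integral _ _ Prest)//; last exact: measurable_fun_walk.
rewrite adde0 (intc (phi (a + 1)))//; last by move=> w [_ ->].
rewrite (intc (phi (a - 1)))//; last by move=> w [_ ->].
rewrite Pup Pdn.
under eq_integral => w.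
  by rewrite inE => /(_ n (leqnn _)) ->; over.
rewrite integral_cst//.
transitivity ((p * phi (a + 1) + (1 - p) * phi (a - 1))%:E * (fine (P C))%:E)%E.
  by rewrite -(fineK fC) -!EFinM -EFinD; congr EFin; ring.
by rewrite fineK.
Qed.

(** Paths of length n + 1 are coded by integer sequences, which are countably
    many, so a known event is a countable disjoint union of cylinders. *)
Lemma known_cylinder n B : known n B ->
  exists F : nat -> set Omega, [/\ B = \bigcup_m F m, trivIset setT F &
    forall m, F m = set0 \/ exists s, F m = cylinder n s].
Proof.
move=> [mB cB].
exists (fun m => if @pickle_inv (seq int) m is Some l then
  [set w | [/\ B w, size l = n.+1 & cylinder n (nth 0 l) w]] else set0).
split.
- apply/seteqP; split=> [w Bw|w [m _]]; last by case: pickle_inv => // l [].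
  exists (pickle (mkseq (Z ^~ w) n.+1)); [exact: I|rewrite pickleK_inv].
  split; [by []|by rewrite size_mkseq|].
  by move=> k kn; rewrite nth_mkseq.
- move=> i j _ _ [w []].
  case ei : pickle_inv => [l|//] [_ sl cl].
  case ej : pickle_inv => [l'|//] [_ sl' cl'].
  have ll' : l = l'.
    apply: (@eq_from_nth _ 0); first by rewrite sl sl'.
    by rewrite sl => k kn; rewrite -cl// cl'.
  have := @pickle_invK (seq int) i; have := @pickle_invK (seq int) j.
  by rewrite ei ej ll' /= => <- <-.
- move=> m; case: pickle_inv => [l|]; last by left.
  have [[w0 [Bw0 sl cl]]|none] := pselect (exists w,
    [/\ B w, size l = n.+1 & cylinder n (nth 0 l) w]); last first.
    by left; apply/seteqP; split=> // w h; apply: none; exists w.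
  right; exists (nth 0 l); apply/seteqP; split=> [w []//|w cw].
  by split=> //; apply: cB Bw0 => k kn; rewrite cl// cw.
Qed.

(** The Markov property in the form used here: conditionally on an event known at
    time n, the walk makes a p-step from its position at time n. *)
Lemma integral_step n B (phi : int -> R) : known n B -> (forall k, 0 <= phi k) ->
  (\int[P]_(w in B) (phi (Z n.+1 w))%:E =
   \int[P]_(w in B) (p * phi (Z n w + 1) + (1 - p) * phi (Z n w - 1))%:E)%E.
Proof.
move=> kB phi0; have [F [BF tF cF]] := known_cylinder kB.
have mF m : measurable (F m).
  by case: (cF m) => [->|[s ->]]; [exact: measurable0|exact: measurable_cylinder].
have mU : measurable (\bigcup_m F m) by exact: bigcup_measurable.
rewrite BF !ge0_integral_bigcup//.
- apply: eq_eseriesr => m _; case: (cF m) => [->|[s ->]].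
    by rewrite !integral_set0.
  exact: cylinder_integral_step.
- exact: (measurable_fun_walk n (fun k => p * phi (k + 1) + (1 - p) * phi (k - 1))).
- by move=> w _; rewrite lee_fin addr_ge0// mulr_ge0// subr_ge0.
- exact: measurable_fun_walk.
- by move=> w _; rewrite lee_fin.
Qed.

Definition adapted tau : Prop :=
  forall t, known t [set w | tle (tau w) (Some t)].

Definition reward tau (v : nat -> int -> R) (w : Omega) : \bar R :=
  if tau w is Some t then (v t (Z t w))%:E else 0%E.

Section stopped_reward.
Context (tau : Omega -> etime) (tau_adapted : adapted tau)
  (v : nat -> int -> R) (v_ge0 : forall t k, 0 <= v t k).

Definition alive n : set Omega := [set w | tlt (Some n) (tau w)].
Definition stopped n : set Omega := [set w | tau w = Some n].
(** The event that tau is at least n, in a form that shows that it is known one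
    period earlier, as [integral_step] requires. *)
Definition not_before n : set Omega :=
  if n is m.+1 then alive m else setT.

Lemma known_alive n : known n (alive n).
Proof.
rewrite (_ : alive n = ~` [set w | tle (tau w) (Some n)]).
  exact: known_setC (tau_adapted n).
by apply/seteqP; split=> w; rewrite /alive /setC/= /tle;
  [move=> h; apply/negP; rewrite negbK|move/negP; rewrite negbK].
Qed.

Lemma known_not_before n : known n (not_before n).
Proof.
case: n => [|n] /=; last exact: known_le (known_alive n).
by rewrite -setC0; apply: known_setC; exact: known_set0.
Qed.

Lemma not_beforeE n : not_before n = stopped n `|` alive n.
Proof.
apply/seteqP; split=> w; rewrite /stopped/alive/=; case: n => [|n] /=.
- by case: (tau w) => [[|t]|] _; [left|right|right].
- rewrite /alive/=; case: (tau w) => [t /=|]; last by right.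
  by rewrite leq_eqVlt => /predU1P[->|]; [left|right].
- by [].
- by rewrite /alive/= => -[->|] //=; case: (tau w) => //= t; exact: leq_trans.
Qed.

Lemma stopped_alive_disjoint n : [disjoint stopped n & alive n].
Proof.
by apply/disj_setPS => w []; rewrite /stopped /alive/= => ->; rewrite /= ltnn.
Qed.

Lemma known_stopped n : known n (stopped n).
Proof.
rewrite (_ : stopped n = not_before n `&` ~` alive n).
  by apply: known_setI; [exact: known_not_before|exact/known_setC/known_alive].
rewrite not_beforeE setIUl setICr setU0; apply/esym/setIidl => w.
by rewrite /stopped /alive/= => ->; rewrite /= ltnn.
Qed.

Lemma reward_ge0 w : (0 <= reward tau v w)%E.
Proof. by rewrite /reward; case: (tau w) => // t; rewrite lee_fin. Qed.

Lemma measurable_reward : measurable_fun setT (reward tau v).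
Proof.
pose F m := if m is t.+1 then stopped t else ~` \bigcup_t stopped t.
have mF m : measurable (F m).
  case: m => [|t] /=; last exact: known_measurable (known_stopped t).
  apply/measurableC/bigcup_measurable => t _.
  exact: known_measurable (known_stopped t).
have -> : setT = \bigcup_m F m.
  apply/seteqP; split=> // w _; case e : (tau w) => [t|].
    by exists t.+1.
  by exists 0%N => // -[t _]; rewrite /stopped/= e.
apply/measurable_fun_bigcup => // -[|t] /=.
  apply: (eq_measurable_fun (cst 0%E)) => [w|]; last exact: measurable_cst.
  rewrite inE /= /reward; case e : (tau w) => [t|] //.
  by case; exists t.
apply: (eq_measurable_fun (fun w => (v t (Z t w))%:E)) => [w|].
  by rewrite inE /stopped/= /reward => ->.
exact: measurable_fun_walk (mF t.+1).
Qed.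

Variable k0 : int.
Let D : set Omega := [set w | Z 0%N w = k0].

Let stop_term n := (\int[P]_(w in D `&` stopped n) (v n (Z n w))%:E)%E.
Let remainder n := (\int[P]_(w in D `&` alive n) (v n (Z n w))%:E)%E.
Let before n := (\int[P]_(w in D `&` not_before n) (v n (Z n w))%:E)%E.

Let knownD n : known n D.
Proof. exact: (known_walk [set k0] (leq0n n)). Qed.

Let mstopped n : measurable (D `&` stopped n).
Proof. exact: known_measurable (known_setI (knownD n) (known_stopped n)). Qed.

Let malive n : measurable (D `&` alive n).
Proof. exact: known_measurable (known_setI (knownD n) (known_alive n)). Qed.

(** The stopped process is followed through its mean on [not_before n], which
    splits into what is cashed at time n and what remains in play. *)
Lemma reward_before n : before n = (stop_term n + remainder n)%E.
Proof.
rewrite /before not_beforeE setIUr ge0_integral_setU//=.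
- by apply: measurable_fun_walk; apply: measurableU.
- by move=> w _; rewrite lee_fin.
- apply/disj_setPS => w [[_ h1] [_ h2]].
  by move/disj_setPS : (stopped_alive_disjoint n) => /(_ w); apply.
Qed.

Lemma reward_before0 : before 0 = ((v 0 k0)%:E * P D)%E.
Proof.
rewrite /before /= setIT -integral_cst; last exact: known_measurable (knownD 0).
by apply: eq_integral => w; rewrite inE /D/= => ->.
Qed.

Lemma reward_beforeS n : before n.+1 =
  (\int[P]_(w in D `&` alive n)
    (p * v n.+1 (Z n w + 1) + (1 - p) * v n.+1 (Z n w - 1))%:E)%E.
Proof.
by apply: integral_step => //; apply: known_setI; [exact: knownD|exact: known_alive].
Qed.

Lemma reward_series :
  (\int[P]_(w in D) reward tau v w = \sum_(0 <= t <oo) stop_term t)%E.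
Proof.
transitivity (\int[P]_(w in \bigcup_t (D `&` stopped t)) reward tau v w)%E.
  rewrite integral_mkcond [RHS]integral_mkcond; apply: eq_integral => w _.
  rewrite !patchE; case: ifPn => [|nD]; case: ifPn => [|nU] //.
  - rewrite inE => Dw; rewrite /reward; case e : (tau w) => [t|//].
    by case/negP : nU; rewrite inE; exists t.
  - by rewrite inE => -[t _ [Dw _]]; case/negP : nD; rewrite inE.
rewrite ge0_integral_bigcup//.
- apply: eq_eseriesr => t _; apply: eq_integral => w.
  by rewrite inE /reward => -[_ ->].
- exact: measurable_funS measurable_reward.
- by move=> w _; exact: reward_ge0.
- by move=> i j _ _ [w [[_ +] [_ +]]]; rewrite /stopped/= => -> [].
Qed.

Lemma stop_term_ge0 n : (0 <= stop_term n)%E.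
Proof. by apply: integral_ge0 => w _; rewrite lee_fin. Qed.

(** What is cashed before time n plus the mean still in play at n never exceeds
    the initial value, and the latter mean is nonnegative. *)
Lemma reward_le_supermartingale :
  (forall t w, Z 0%N w = k0 -> tlt (Some t) (tau w) ->
    p * v t.+1 (Z t w + 1) + (1 - p) * v t.+1 (Z t w - 1) <= v t (Z t w)) ->
  (\int[P]_(w in D) reward tau v w <= (v 0 k0)%:E * P D)%E.
Proof.
move=> super; rewrite reward_series.
have drop n : (before n.+1 <= remainder n)%E.
  rewrite reward_beforeS; apply: ge0_le_integral => //.
  - by move=> w _; rewrite lee_fin addr_ge0// mulr_ge0// subr_ge0.
  - exact: (measurable_fun_walk n
      (fun k => p * v n.+1 (k + 1) + (1 - p) * v n.+1 (k - 1))).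
  - exact: measurable_fun_walk.
  - by move=> w [Dw aw]; rewrite lee_fin; exact: super.
have partial n : (\sum_(0 <= t < n) stop_term t + before n <= (v 0 k0)%:E * P D)%E.
  elim: n => [|n IH]; first by rewrite big_nil add0e reward_before0.
  rewrite big_nat_recr//= -addeA; apply: le_trans IH.
  by apply: leeD2l; rewrite (reward_before n); exact: leeD2l.
apply: lime_le; first by apply: is_cvg_nneseries => n _ _; exact: stop_term_ge0.
apply: nearW => n; apply: le_trans (partial n); rewrite leeDl//.
by apply: integral_ge0 => w _; rewrite lee_fin.
Qed.

(** Dual bound. The mass never cashed is controlled by the uniform bound eps,
    which vanishes: in the game it is a multiple of the discount factor. *)
Lemma reward_ge_submartingale (eps : nat -> R) : eps n @[n --> \oo] --> (0 : R) ->
  (forall t k, v t k <= eps t) ->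
  (forall t w, Z 0%N w = k0 -> tlt (Some t) (tau w) ->
    v t (Z t w) <= p * v t.+1 (Z t w + 1) + (1 - p) * v t.+1 (Z t w - 1)) ->
  ((v 0 k0)%:E * P D <= \int[P]_(w in D) reward tau v w)%E.
Proof.
move=> eps0 v_eps sub; rewrite reward_series.
have drop n : (remainder n <= before n.+1)%E.
  rewrite reward_beforeS; apply: ge0_le_integral => //.
  - by move=> w _; rewrite lee_fin.
  - exact: measurable_fun_walk.
  - exact: (measurable_fun_walk n
      (fun k => p * v n.+1 (k + 1) + (1 - p) * v n.+1 (k - 1))).
  - by move=> w [Dw aw]; rewrite lee_fin; exact: sub.
have partial n : ((v 0 k0)%:E * P D <= \sum_(0 <= t < n) stop_term t + before n)%E.
  elim: n => [|n IH]; first by rewrite big_nil add0e reward_before0.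
  rewrite big_nat_recr//= -addeA; apply: le_trans IH _.
  by apply: leeD2l; rewrite (reward_before n); exact: leeD2l.
have small n : (before n <= (eps n)%:E)%E.
  have mB : measurable (D `&` not_before n).
    exact: known_measurable (known_setI (knownD n) (known_not_before n)).
  have e0 : 0 <= eps n by exact: le_trans (v_ge0 n 0) (v_eps n 0).
  apply: (@le_trans _ _ (\int[P]_(w in D `&` not_before n) cst (eps n)%:E w)%E).
    by apply: ge0_le_integral => // [w _||w _]; rewrite ?lee_fin//;
      exact: measurable_fun_walk.
  by rewrite integral_cst// -[leRHS]mule1 lee_wpmul2l ?lee_fin// probability_le1.
apply/lee_addgt0Pr => e e_gt0.
have [n _ /(_ n (leqnn n)) /= en] := cvgr_lt _ eps0 e e_gt0.
apply: le_trans (partial n) _; apply: leeD.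
  by apply: nneseries_lim_ge => i _ _; exact: stop_term_ge0.
by apply: le_trans (small n) _; rewrite lee_fin ltW.
Qed.

End stopped_reward.

End walk.

(** * Passage times and stopping times *)

Section passage_times.
Implicit Types (A : set nat) (a b : etime) (t s : nat).

Lemma first_time_spec A :
  match first_time A with
  | Some t => A t /\ forall s, A s -> (t <= s)%N
  | None => forall s, ~ A s
  end.
Proof.
rewrite /first_time; case: pselect => [exA|noA].
  case: ex_minnP => t /asboolP At minA; split=> // s As.
  by apply: minA; exact/asboolP.
by move=> s As; apply: noA; exists s; exact/asboolP.
Qed.

Lemma first_time_leP A t :
  tle (first_time A) (Some t) <-> exists2 s, (s <= t)%N & A s.
Proof.
have := first_time_spec A; rewrite /tle; case: first_time => [r|] /=.
  by rewrite -leqNgt => -[Ar minA]; split=> [rt|[s st /minA /leq_trans]];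
    [exists r|apply].
by move=> noA; split=> // -[s _ /noA].
Qed.

Lemma before_first_time A t : tlt (Some t) (first_time A) -> ~ A t.
Proof.
have := first_time_spec A; case: first_time => [r|//] /= [_ minA] tr /minA.
by rewrite leqNgt tr.
Qed.

Lemma tlt_le_trans a b t : tlt (Some t) a -> tle a b -> tlt (Some t) b.
Proof.
rewrite /tle; case: a => [a|]; case: b => [b|] //=.
by rewrite -leqNgt; exact: leq_trans.
Qed.

Lemma tle_trans a b c : tle a b -> tle b c -> tle a c.
Proof.
rewrite /tle; case: a => [a|]; case: b => [b|]; case: c => [c|] //=.
by rewrite -!leqNgt; exact: leq_trans.
Qed.

Definition emin a b : etime := if tle a b then a else b.

Lemma tlt_emin t a b : tlt (Some t) (emin a b) = tlt (Some t) a && tlt (Some t) b.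
Proof.
rewrite /emin /tle; case: a b => [a|] [b|] //=; rewrite ?andbT//.
case: ltnP => /= h; first by rewrite andb_idl// => /ltn_trans; apply.
by rewrite andb_idr// => /leq_trans; apply.
Qed.

Variables (E Omega : Type) (X : nat -> Omega -> E).

Lemma hit_pos_antitone (S S' : set E) w : S `<=` S' ->
  tle (hit_pos X S' w) (hit_pos X S w).
Proof.
move=> SS'; have := first_time_spec [set t | (0 < t)%N /\ S (X t w)].
rewrite -/(hit_pos X S w); case: hit_pos => [t|_]; last first.
  by rewrite /tle; case: hit_pos.
by move=> [[t0 /SS' S't] _]; apply/first_time_leP; exists t.
Qed.

Lemma hit_pos_ge1 (S : set E) w : tle (Some 1%N) (hit_pos X S w).
Proof.
have := first_time_spec [set t | (0 < t)%N /\ S (X t w)].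
rewrite -/(hit_pos X S w); case: hit_pos => [t [[t0 _] _]|//].
by rewrite /tle/= -leqNgt.
Qed.

Lemma filtration_sigma_algebra n :
  sigma_algebra [set: Omega] (natural_filtration X n).
Proof. exact: smallest_sigma_algebra. Qed.

Lemma stopping_first_time (c : nat -> bool) (S : set E) :
  stopping_time X (fun w => first_time [set t | c t /\ S (X t w)]).
Proof.
move=> t; have [F0 _ FU] := filtration_sigma_algebra t.
have -> : [set w | tle (first_time [set s | c s /\ S (X s w)]) (Some t)] =
    \bigcup_s (if (s <= t)%N && c s then X s @^-1` S else set0).
  apply/seteqP; split=> w.
    by move=> /first_time_leP[s st [cs Ss]]; exists s => //; rewrite st cs.
  move=> [s _]; case: ifP => [/andP[st cs] Ss|//].
  by apply/first_time_leP; exists s.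
apply: FU => s; case: ifP => [/andP[st _]|_]; last exact: F0.
by apply: sub_sigma_algebra; exists s, S.
Qed.

Lemma stopping_hit_pos (S : set E) : stopping_time X (hit_pos X S).
Proof. exact: (stopping_first_time (fun t => (0 < t)%N)). Qed.

Lemma stopping_hit (S : set E) : stopping_time X (hit X S).
Proof.
rewrite (_ : hit X S = fun w => first_time [set t | true /\ S (X t w)]).
  exact: (stopping_first_time xpredT).
apply/funext => w; congr first_time; apply/seteqP; split=> t //=.
by case.
Qed.

Lemma hit_set0 w : hit X set0 w = None.
Proof.
by have := first_time_spec [set t | set0 (X t w)]; rewrite -/(hit X set0 w);
  case: hit => // t [].
Qed.

End passage_times.

(** The natural filtration of a process coded injectively by the walk only
    contains events known to the walk. *)
Lemma stopping_adapted (R : realType) (p : R) (d : measure_display)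
    (Omega : measurableType d) (P : probability Omega R) (E : Type)
    (X : nat -> Omega -> E) (code : E -> int) (tau : Omega -> etime) :
  injective code ->
  markov_chain (walk_step p) P (fun t w => code (X t w)) ->
  stopping_time X tau -> adapted (fun t w => code (X t w)) tau.
Proof.
move=> code_inj walk stop t; apply: smallest_sub (stop t).
  exact: known_sigma_algebra.
move=> _ [k [A [kt ->]]]; split.
  have -> : X k @^-1` A = (fun w => code (X k w)) @^-1` (code @` A).
    apply/seteqP; split=> w /=; first by exists (X k w).
    by move=> [y Ay /code_inj <-].
  exact: (walk.1 k).
by move=> w w' /(_ k kt) /code_inj; rewrite /preimage/= => ->.
Qed.

Section adapted_times.
Context (R : realType) (p : R) (d : measure_display)
  (Omega : measurableType d) (P : probability Omega R)
  (Z : nat -> Omega -> int) (Z_walk : markov_chain (walk_step p) P Z).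

Lemma adapted_const s : adapted Z (fun=> Some s).
Proof.
move=> t; have [st|st] := boolP (s <= t)%N.
  rewrite (_ : [set _ | _] = setT).
    rewrite -setC0; apply: known_setC; exact: known_set0.
  by apply/seteqP; split=> // w _; rewrite /= /tle/= -leqNgt.
rewrite (_ : [set _ | _] = set0); first exact: known_set0.
by apply/seteqP; split=> // w; rewrite /= /tle/= -leqNgt (negbTE st).
Qed.

Lemma adapted_emin (tau sigma : Omega -> etime) : adapted Z tau ->
  adapted Z sigma -> adapted Z (fun w => emin (tau w) (sigma w)).
Proof.
move=> tau_ad sigma_ad t.
rewrite (_ : [set w | _] =
  ~` (~` [set w | tle (tau w) (Some t)] `&` ~` [set w | tle (sigma w) (Some t)])).
  by apply: known_setC; apply: known_setI; exact: known_setC.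
apply/seteqP; split=> w; rewrite /setC /setI /mkset /tle tlt_emin negb_and.
  by move=> /orP h [h1 h2]; case: h.
by move=> /not_andP[] /contrapT ->; rewrite ?orbT.
Qed.

End adapted_times.

(** * Prices and their heights *)

Section price_lattice.
Context (R : realType) (u : R) (u_gt1 : 1 < u).

Let u_gt0 : 0 < u. Proof. exact: lt_trans u_gt1. Qed.

Let u_neq0 : u != 0. Proof. by rewrite gt_eqF. Qed.

Definition height (x : state u) : int := projT1 (cid (set_mem (valP x))).

Lemma heightE (x : state u) : set_val x = u ^ height x.
Proof. by rewrite /height; case: cid. Qed.

Lemma powers_exp j : u ^ j \in powers u.
Proof. by rewrite inE; exists j. Qed.

Definition at_height j : state u := exist _ (u ^ j) (powers_exp j).

Lemma le_upow i j : (u ^ i <= u ^ j) = (i <= j).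
Proof. exact: ler_eXz2l. Qed.

Lemma upow_inj : injective (fun j : int => u ^ j).
Proof. by move=> i j e; apply: le_anti; rewrite -!le_upow e lexx. Qed.

Lemma height_inj : injective height.
Proof. by move=> x y e; apply: val_inj; rewrite -!set_valE !heightE e. Qed.

Lemma at_heightK : cancel at_height height.
Proof. by move=> j; apply: upow_inj; rewrite /= -heightE. Qed.

Lemma heightK : cancel height at_height.
Proof. by move=> x; apply: height_inj; rewrite at_heightK. Qed.

Lemma upow_gt0 j : 0 < u ^ j. Proof. exact: exprz_gt0. Qed.

Lemma upowS j : u ^ (j + 1) = u ^ j * u.
Proof. by rewrite expfzDr ?u_neq0// expr1z. Qed.

Lemma upow_pred j : u ^ (j - 1) = u ^ j / u.
Proof. by rewrite expfzDr. Qed.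

Lemma upow_unbounded (c : R) : exists n : nat, c < u ^ n.
Proof.
have bern n : 1 + n%:R * (u - 1) <= u ^+ n.
  elim: n => [|n IH]; first by rewrite mul0r addr0 expr0.
  rewrite exprSr; apply: le_trans (ler_wpM2r (ltW u_gt0) IH).
  rewrite -natr1; have : 0 <= n%:R * (u - 1) * (u - 1) by
    rewrite !mulr_ge0// subr_ge0 ltW.
  lra.
have um0 : 0 < u - 1 by rewrite subr_gt0.
exists (Num.trunc (`|c| / (u - 1))).+1.
apply: lt_le_trans (bern _).
have := truncnS_gt (`|c| / (u - 1)); rewrite ltr_pdivrMr// => h.
have := ler_norm c; lra.
Qed.

Lemma upow_small (c : R) : 0 < c -> exists n : nat, u ^ (- n%:Z) < c.
Proof.
move=> c0; have [n] := upow_unbounded c^-1; exists n.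
by rewrite -invr_expz -[ltRHS]invrK ltf_pV2 ?posrE ?invr_gt0 ?upow_gt0.
Qed.

(** Powers below c exist, so the heights of the powers above c are bounded below
    and one of them is the least. *)
Lemma least_power (c : R) : 0 < c ->
  exists j : int, c <= u ^ j /\ forall i, c <= u ^ i -> j <= i.
Proof.
move=> c0; have [m um] := upow_small c0; have [n un] := upow_unbounded c.
have ex : exists i : nat, c <= u ^ (i%:Z - m%:Z).
  by exists (n + m)%N; rewrite PoszD addrK ltW.
case: (ex_minnP ex) => i ci min_i; exists (i%:Z - m%:Z); split=> // k ck.
have mk : - m%:Z <= k by rewrite -le_upow; apply: ltW; exact: lt_le_trans ck.
have kE : (absz (k + m%:Z))%:Z - m%:Z = k by lia.
by have := min_i (absz (k + m%:Z)); rewrite kE => /(_ ck); lia.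
Qed.

Lemma thresholdE (K a : R) : 0 < (1 - a) / (u - a) * K ->
  exists j : int, [/\ threshold u K a = u ^ j,
    (1 - a) / (u - a) * K <= u ^ j &
    forall i, i < j -> u ^ i < (1 - a) / (u - a) * K].
Proof.
move=> c0; have [j [cj min_j]] := least_power c0; exists j; split=> //.
  rewrite /threshold /minimum; apply: xget_unique.
    split; first by split=> //; exists j.
    by move=> y [/= ci [i yi]]; rewrite yi le_upow min_j// -yi.
  move=> y [[/= ci [i yi]] lb]; apply: le_anti; apply/andP; split.
    by apply: lb; split=> //; exists j.
  by rewrite yi le_upow min_j// -yi.
by move=> i ij; rewrite ltNge; apply/negP => /min_j; rewrite leNgt ij.
Qed.

Lemma height_walk (p : R) (d : measure_display) (Omega : measurableType d)
    (P : probability Omega R) (X : nat -> Omega -> state u) :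
  markov_chain (@state_step R u p) P X ->
  markov_chain (walk_step p) P (fun t w => height (X t w)).
Proof.
move=> [X_meas X_step]; split=> [t A|n s].
  exact: (X_meas t (height @^-1` A)).
have pathE m : [set w | forall k, (k <= m)%N -> height (X k w) = s k] =
    [set w | forall k, (k <= m)%N -> X k w = at_height (s k)].
  apply/seteqP; split=> w path k km; last by rewrite path// at_heightK.
  by rewrite -(path k km) heightK.
rewrite !pathE X_step; congr (_ * _%:E)%E.
rewrite /state_step /walk_step /=.
rewrite invr_expz -expfzDr ?u_neq0//.
have eq1 k : (u ^ k == u) = (k == 1).
  by rewrite -[X in _ == X]expr1z (inj_eq upow_inj).
have eqN1 k : (u ^ k == u^-1) = (k == - 1).
  by rewrite -[u^-1]exprN1 (inj_eq upow_inj).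
by rewrite eq1 eqN1.
Qed.

End price_lattice.

(** * The expected payoff of one firm *)

Section one_firm.
Context (R : realType) (u p : R) (u_gt1 : 1 < u) (p_gt0 : 0 < p)
  (p_lt1 : p < 1) (p_ge : (u + 1)^-1 <= p).
Context (d : measure_display) (Omega : measurableType d)
  (P : state u -> probability Omega R) (X : nat -> Omega -> state u)
  (X_markov : markov_family (@state_step R u p) P X).
Context (K N b : R) (h : state u -> R) (K_gt0 : 0 < K) (K_le : K <= N)
  (b_gt0 : 0 < b)
  (h_bounds : forall x, Num.max (K - set_val x) 0 <= h x <= N).

Local Notation i := (firm K N b h).
Local Notation disc := (hyperbolic b).
Local Notation A := (hit_value p b).
Local Notation Z := (fun t w => height (X t w)).
Implicit Types (x y : state u) (j k : int) (t n m : nat) (D : R)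
  (tau sigma : Omega -> etime) (S T : set (state u)).

Definition put j : R := Num.max (K - u ^ j) 0.

Definition below j : set (state u) := [set x | height x <= j].

Let p_ge0 : 0 <= p. Proof. exact: ltW. Qed.
Let p_le1 : p <= 1. Proof. exact: ltW. Qed.
Let q_ge0 : 0 <= 1 - p. Proof. by rewrite subr_ge0. Qed.
Let disc_ge0 t : 0 <= disc t. Proof. exact: hyperbolic_ge0. Qed.
Let A_ge0 t k : 0 <= A t k. Proof. exact: hit_value_ge0. Qed.

Lemma put_ge0 j : 0 <= put j. Proof. by rewrite le_max lexx orbT. Qed.

Lemma put_ge j : K - u ^ j <= put j. Proof. by rewrite le_max lexx. Qed.

Lemma put_le j : put j <= K.
Proof. by rewrite ge_max gerBl (ltW K_gt0) andbT ltW// upow_gt0. Qed.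

Lemma putE j : u ^ j <= K -> put j = K - u ^ j.
Proof. by move=> jK; apply/max_idPl; rewrite subr_ge0. Qed.

Lemma payoff_firstE x : payoff_first i x = put (height x).
Proof. by rewrite /= heightE. Qed.

Lemma height_markov x : markov_chain (walk_step p) (P x) Z.
Proof. exact: height_walk (X_markov x).1. Qed.

Lemma stopping_adapted_height x tau : stopping_time X tau -> adapted Z tau.
Proof. exact: stopping_adapted (@height_inj R u) (height_markov x). Qed.

Let h_ge0 x : 0 <= h x.
Proof.
by case/andP: (h_bounds x) => + _; apply: le_trans; rewrite le_max lexx orbT.
Qed.

(** If nobody ever stops the discounted tie payoff tends to 0, as ties are worth
    at most N. *)
Lemma vanishing_tie w :
  limn_esup (fun t => (disc t * payoff_tie i (X t w))%:E) = 0%E.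
Proof.
apply: (cvg_limn_einf_sup _).2.
apply: cvg_EFin; first exact: nearW.
apply: (@squeeze_cvgr _ _ _ _ (fun=> 0) (fun t => disc t * N)).
- apply: nearW => t; rewrite mulr_ge0//= ler_wpM2l//.
  by case/andP: (h_bounds (X t w)).
- exact: cvg_cst.
- by rewrite -(mul0r N); apply: cvgMl; exact: hyperbolic_cvg0.
Qed.

Lemma payoff_ge0 tau sigma w : (0 <= payoff X i tau sigma w)%E.
Proof.
have N0 : 0 <= N by exact: le_trans (ltW K_gt0) K_le.
have f0 y : 0 <= payoff_first i y by rewrite payoff_firstE put_ge0.
have d0 t : 0 <= discount i t by exact: disc_ge0.
rewrite /payoff; case: (tau w) => [t|]; case: (sigma w) => [s|].
- case: ifP => _; first by rewrite lee_fin mulr_ge0.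
  by case: ifP => _; rewrite lee_fin mulr_ge0//=.
- by rewrite lee_fin mulr_ge0.
- by rewrite lee_fin mulr_ge0.
- by rewrite vanishing_tie.
Qed.

Lemma start_probability x : P x [set w | height (X 0%N w) = height x] = 1%E.
Proof.
rewrite -[RHS](X_markov x).2; congr (P x _); apply/seteqP.
by split=> w /=; [exact: height_inj|move=> ->].
Qed.

Lemma integral_start x (G : Omega -> \bar R) : measurable_fun setT G ->
  (forall w, 0 <= G w)%E ->
  (\int[P x]_w G w = \int[P x]_(w in [set w | height (X 0%N w) = height x]) G w)%E.
Proof.
move=> mG G0; set D := [set w | _].
have mD : measurable D by exact: ((height_markov x).1 0%N [set height x]).
rewrite -(setvU D) ge0_integral_setU//=.
- have PDc : P x (~` D) = 0%E.
    by rewrite probability_setC// start_probability subee.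
  rewrite [X in (X + _)%E](null_set_integral _ _ PDc) ?add0e//.
    exact: measurableC.
  exact: measurable_funS mG.
- exact: measurableC.
- exact: measurable_funS mG.
- by apply/disj_setPS => w [].
Qed.

(** Upper and lower bounds on expected payoffs: dominate the payoff by the reward
    of v at one time theta, then stop v optionally at theta. *)
Lemma J_le_supermartingale x tau sigma (theta : Omega -> etime)
    (v : nat -> int -> R) :
  adapted Z theta -> (forall t k, 0 <= v t k) ->
  (forall w, payoff X i tau sigma w <= reward Z theta v w)%E ->
  (forall t w, height (X 0%N w) = height x -> tlt (Some t) (theta w) ->
    p * v t.+1 (height (X t w) + 1) + (1 - p) * v t.+1 (height (X t w) - 1)
    <= v t (height (X t w))) ->
  (J P X i x tau sigma <= (v 0%N (height x))%:E)%E.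
Proof.
move=> theta_ad v0 le_reward super.
apply: le_trans (le_integral_nonneg (P x) (payoff_ge0 tau sigma) le_reward) _.
rewrite integral_start; last 2 first.
- exact: (measurable_reward (height_markov x)).
- by move=> w; exact: reward_ge0.
have := reward_le_supermartingale p_ge0 p_le1 (height_markov x) theta_ad v0 super.
by rewrite start_probability mule1.
Qed.

Lemma J_ge_submartingale x tau sigma (theta : Omega -> etime)
    (v : nat -> int -> R) (c : R) :
  adapted Z theta -> (forall t k, 0 <= v t k <= c * disc t) ->
  (forall w, reward Z theta v w <= payoff X i tau sigma w)%E ->
  (forall t w, height (X 0%N w) = height x -> tlt (Some t) (theta w) ->
    v t (height (X t w)) <=
    p * v t.+1 (height (X t w) + 1) + (1 - p) * v t.+1 (height (X t w) - 1)) ->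
  ((v 0%N (height x))%:E <= J P X i x tau sigma)%E.
Proof.
move=> theta_ad v_bounds ge_reward sub.
have v0 t k : 0 <= v t k by case/andP: (v_bounds t k).
have v1 t k : v t k <= c * disc t by case/andP: (v_bounds t k).
have r0 w : (0 <= reward Z theta v w)%E by exact: reward_ge0.
apply: le_trans (le_integral_nonneg (P x) r0 ge_reward).
rewrite integral_start//; last exact: (measurable_reward (height_markov x)).
have c0 : c * disc n @[n --> \oo] --> (0 : R).
  by rewrite -(mulr0 c); apply: cvgMr; exact: hyperbolic_cvg0.
have := reward_ge_submartingale p_ge0 p_le1 (height_markov x) theta_ad v0 c0 v1 sub.
by rewrite start_probability mule1.
Qed.

(** * Iterates of Phi and equilibria *)

(** Returning to a larger set happens earlier, hence is one of the plans
    competing in V. *)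
Lemma J_continue_le_V T S S' x : S `<=` S' ->
  (J_continue P X i T S' x <= V P X i T x S)%E.
Proof.
move=> SS'; apply: ereal_sup_ubound; exists (hit_pos X S') => //.
split; first exact: stopping_hit_pos.
by move=> w; rewrite hit_pos_ge1 hit_pos_antitone.
Qed.

Lemma V_le T S x (c : \bar R) :
  (forall tau, stopping_time X tau ->
    (forall w, tle (Some 1%N) (tau w)) ->
    (forall w, tle (tau w) (hit_pos X S w)) ->
    J P X i x tau (hit X T) <= c)%E ->
  (V P X i T x S <= c)%E.
Proof.
move=> Jc; apply: ge_ereal_sup => _ [tau [tau_stop tau_range] <-].
by apply: Jc => // w; case/andP: (tau_range w).
Qed.

Lemma V_antitone T S S' x : S `<=` S' ->
  (V P X i T x S' <= V P X i T x S)%E.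
Proof.
move=> SS'; apply: V_le => tau tau_stop tau1 tauS'.
apply: ereal_sup_ubound; exists tau => //; split=> // w; rewrite tau1/=.
exact: tle_trans (tauS' w) (hit_pos_antitone X w SS').
Qed.

Lemma Phi_monotone T S S' : S `<=` S' -> Phi P X i T S `<=` Phi P X i T S'.
Proof.
move=> SS' x [/SS'|[_ VJ]]; first by left.
have [S'x|S'x] := pselect (S' x); [by left|right; split=> //].
exact: le_lt_trans (V_antitone T x SS') VJ.
Qed.

Lemma iter_Phi_sub_Gamma T n : iter n (Phi P X i T) set0 `<=` Gamma P X i T.
Proof. by case: n => [x []|n x Sx]; exists n. Qed.

(** A state enters the iterates because stopping strictly beats every plan that
    ends no later than the return to the current iterate; returning to an equilibrium
    that contains the iterate is such a plan, so the state must belong to the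
    equilibrium. *)
Lemma iter_Phi_sub_equilibrium T S' n : intra_equilibrium P X i T S' ->
  iter n (Phi P X i T) set0 `<=` S'.
Proof.
move=> S'eq; elim: n => [x []|n IH x [/IH //|[_ VJ]]].
have [//|S'x] := pselect (S' x); rewrite -S'eq; right; split=> //.
exact: le_lt_trans (J_continue_le_V T x IH) VJ.
Qed.

Lemma Gamma_sub_equilibrium T S' : intra_equilibrium P X i T S' ->
  Gamma P X i T `<=` S'.
Proof.
by move=> S'eq x [n _]; exact: (iter_Phi_sub_equilibrium (n := n.+1) S'eq).
Qed.

(** The same comparison for any S' that contains Gamma: it is made at the iterate
    at which x enters. *)
Lemma J_continue_lt_on_Gamma T S' x : Gamma P X i T `<=` S' ->
  Gamma P X i T x -> (J_continue P X i T S' x < J_stop P X i T x)%E.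
Proof.
move=> GS' [n _]; elim: n.+1 => {n} [//|n IH [//|[_ VJ]]].
apply: le_lt_trans VJ; apply: J_continue_le_V.
by apply: subset_trans GS'; exact: iter_Phi_sub_Gamma.
Qed.

(** * A firm whose opponent never stops *)

Lemma above_before_barrier j x tau t w :
  j < height x -> (tle (tau w) (hit_pos X (below j) w)) ->
  height (X 0%N w) = height x -> tlt (Some t) (tau w) ->
  j < height (X t w).
Proof.
move=> jx tau_le start tw; case: t tw => [|t] tw; first by rewrite start.
have /before_first_time nb := tlt_le_trans tw tau_le.
by rewrite ltNge; apply/negP => le_j; apply: nb.
Qed.

(** The value at time t and height k of waiting for the barrier j, increased by a
    constant D above the barrier. Above j it satisfies the one-step equation up
    to a nonnegative term; at and below j it is the payoff of stopping. *)
Definition barrier_value j D t k : R :=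
  if k <= j then disc t * put k else put j * A t (k - j) + D.

Lemma barrier_value_ge0 j D t k : 0 <= D -> 0 <= barrier_value j D t k.
Proof.
move=> D0; rewrite /barrier_value; case: ifP => _.
  by rewrite mulr_ge0// put_ge0.
by rewrite addr_ge0// mulr_ge0// put_ge0.
Qed.

Lemma barrier_value0_le j t k : barrier_value j 0 t k <= K * disc t.
Proof.
rewrite /barrier_value; case: ifP => _.
  by rewrite mulrC ler_wpM2r// put_le.
by rewrite addr0 ler_pM// ?put_ge0 ?put_le// hit_value_le.
Qed.

Lemma barrier_value_step j D t k : j < k ->
  barrier_value j D t k = p * barrier_value j D t.+1 (k + 1)
    + (1 - p) * barrier_value j D t.+1 (k - 1)
    + (if k == j + 1 then (1 - p) * D else 0).
Proof.
move=> jk; rewrite /barrier_value.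
rewrite (_ : (k <= j) = false); last by clear - jk; lia.
rewrite (_ : (k + 1 <= j) = false); last by clear - jk; lia.
rewrite (hit_value_rec p_ge0 p_le1 b_gt0); last by clear - jk; lia.
rewrite (_ : k + 1 - j = k - j + 1); last by clear - jk; lia.
have [->|kj] := eqVneq k (j + 1).
  rewrite addrK lexx (_ : j + 1 - j - 1 = 0); last by clear; lia.
  by rewrite hit_value0; ring.
rewrite (_ : (k - 1 <= j) = false); last by clear - jk kj; lia.
rewrite (_ : k - 1 - j = k - j - 1); last by clear - jk; lia.
ring.
Qed.

Lemma lone_payoff tau w : payoff X i tau (hit X set0) w =
  if tau w is Some t then (disc t * put (height (X t w)))%:E else 0%E.
Proof.
rewrite /payoff hit_set0; case: (tau w) => [t|]; last exact: vanishing_tie.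
by rewrite payoff_firstE.
Qed.

Lemma lone_J_stop x : J_stop P X i set0 x = (put (height x))%:E.
Proof.
pose v t k := if t is 0%N then put k else 0.
have v0 t k : 0 <= v t k by case: t => //=; exact: put_ge0.
have none (t : nat) (w : Omega) : tlt (Some t) (Some 0%N) -> False by [].
have eq_reward w : payoff X i (fun=> Some 0%N) (hit X set0) w =
    reward Z (fun=> Some 0%N) v w.
  by rewrite lone_payoff /reward/= hyperbolic0 mul1r.
apply: le_anti; apply/andP; split.
- apply: (J_le_supermartingale (theta := fun=> Some 0%N) (v := v)) => //.
  + exact: adapted_const.
  + by move=> w; rewrite eq_reward.
- apply: (J_ge_submartingale (theta := fun=> Some 0%N) (v := v) (c := K)) => //.
  + exact: adapted_const.
  + move=> t k; rewrite v0; case: t => [|t] /=; last by rewrite mulr_ge0// ltW.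
    by rewrite hyperbolic0 mulr1 put_le.
  + by move=> w; rewrite eq_reward.
Qed.

(** If stopping immediately is never better by more than D than waiting for the
    barrier, then a plan delayed by one period gains at most disc 1 * D over
    waiting. Indeed disc t * put k <= disc t * (put j * A(0, k - j) + D), and
    disc t * A(0, k - j) <= A(t, k - j) by decreasing impatience while
    disc t <= disc 1, so [barrier_value] with constant disc 1 * D dominates. *)
Lemma lone_J_le_barrier j D x tau : stopping_time X tau ->
  (forall w, tle (Some 1%N) (tau w)) ->
  (forall w, tle (tau w) (hit_pos X (below j) w)) ->
  j < height x -> 0 <= D ->
  (forall k, j < k -> put k <= put j * A 0 (k - j) + D) ->
  (J P X i x tau (hit X set0) <=
    (put j * A 0 (height x - j) + disc 1 * D)%:E)%E.
Proof.
move=> tau_stop tau1 tau_le jx D0 dom.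
have D'0 : 0 <= disc 1 * D by rewrite mulr_ge0.
have -> : put j * A 0 (height x - j) + disc 1 * D =
    barrier_value j (disc 1 * D) 0 (height x).
  by rewrite /barrier_value leNgt jx.
apply: (J_le_supermartingale (theta := tau)).
- exact: (stopping_adapted_height x tau_stop).
- by move=> t k; exact: barrier_value_ge0.
- move=> w; rewrite lone_payoff /reward; case e : (tau w) => [t|//].
  rewrite lee_fin /barrier_value; case: (leP _ j) => // jt.
  apply: le_trans (ler_wpM2l (disc_ge0 t) (dom _ jt)) _.
  rewrite mulrDr mulrCA lerD// ?ler_wpM2l ?put_ge0 ?hit_value_delay//.
  rewrite ler_wpM2r// hyperbolic_antitone//.
  by have := tau1 w; rewrite e /tle/= -leqNgt.
- move=> t w start tw.
  have jt := above_before_barrier jx (tau_le w) start tw.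
  rewrite [leRHS]barrier_value_step// lerDl; case: ifP => // _.
  by rewrite mulr_ge0.
Qed.

Lemma lone_J_continue_ge j x : j < height x ->
  ((put j * A 0 (height x - j))%:E <= J_continue P X i set0 (below j) x)%E.
Proof.
move=> jx.
have -> : put j * A 0 (height x - j) = barrier_value j 0 0 (height x).
  by rewrite /barrier_value addr0 leNgt jx.
apply: (J_ge_submartingale (theta := hit_pos X (below j)) (c := K)).
- by apply: (stopping_adapted_height x); exact: stopping_hit_pos.
- by move=> t k; rewrite barrier_value_ge0// barrier_value0_le.
- move=> w; rewrite lone_payoff /reward.
  have := first_time_spec [set t | (0 < t)%N /\ below j (X t w)].
  rewrite -/(hit_pos X (below j) w); case: hit_pos => [t [[_ tj] _]|//].
  by rewrite /barrier_value tj.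
- move=> t w start tw.
  have jt : j < height (X t w).
    by apply: (above_before_barrier (x := x) (tau := hit_pos X (below j))) tw => //;
      rewrite /tle; case: hit_pos => //= s; rewrite ltnn.
  rewrite [leLHS]barrier_value_step//.
  by case: ifP => _; rewrite ?mulr0 addr0.
Qed.

(** A price x below an element y of S stays at or below y until the return to S, and
    there the put payoff K - x is a supermartingale because the price is a
    submartingale; the delay costs at least the factor disc 1. *)
Lemma lone_J_le_below S y x tau : stopping_time X tau ->
  (forall w, tle (Some 1%N) (tau w)) ->
  (forall w, tle (tau w) (hit_pos X S w)) ->
  S y -> height x < height y -> u ^ height y <= K ->
  (J P X i x tau (hit X set0) <= (disc 1 * (K - u ^ height x))%:E)%E.
Proof.
move=> tau_stop tau1 tau_le Sy xy yK; set m := height y.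
(* The value K above m, never reached from below without visiting m, makes v a
   supermartingale at every height other than m. *)
pose v (t : nat) k : R := disc 1 * (if k <= m then K - u ^ k else K).
have -> : disc 1 * (K - u ^ height x) = v 0%N (height x).
  by rewrite /v (ltW xy).
have um k : k <= m -> u ^ k <= K.
  by move=> km; apply: le_trans yK; rewrite le_upow.
apply: (J_le_supermartingale (theta := tau)).
- exact: (stopping_adapted_height x tau_stop).
- move=> t k; rewrite /v mulr_ge0//; case: ifP => [km|_]; last exact: ltW.
  by rewrite subr_ge0 um.
- move=> w; rewrite lone_payoff /reward; case e : (tau w) => [t|//].
  rewrite lee_fin /v; apply: ler_pM => //; first exact: put_ge0.
    by apply: hyperbolic_antitone => //; have := tau1 w; rewrite e /tle/= -leqNgt.
  by case: ifP => [km|_]; rewrite ?put_le// putE// um.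
- move=> t w start tw.
  have neq : height (X t w) != m.
    case: t tw => [|t] tw; first by rewrite start lt_eqF.
    have /before_first_time nb := tlt_le_trans tw (tau_le w).
    by apply/eqP => /height_inj e; apply: nb; split=> //; rewrite e.
  rewrite /v !(mulrCA _ (disc 1)) -mulrDr ler_wpM2l//.
  move: (height (X t w)) neq => k neq.
  case: ifP => k1; case: ifP => k2; case: ifP => k3;
    try by exfalso; clear - k1 k2 k3 neq; lia.
  + rewrite upowS// upow_pred//.
    have drift : 1 <= p * u + (1 - p) / u.
      have u0 : 0 < u by exact: lt_trans u_gt1.
      have ru : u * u^-1 = 1 by rewrite divff// gt_eqF.
      have r1 : u^-1 <= 1 by rewrite invf_le1// ltW.
      have pu : 1 <= p * (u + 1) by rewrite -ler_pdivrMr ?mul1r//; lra.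
      rewrite -subr_ge0 (_ : _ - 1 = (p * (u + 1) - 1) * (1 - u^-1)).
        by rewrite mulr_ge0// subr_ge0.
      apply/eqP; rewrite -subr_eq0.
      rewrite (_ : _ - _ = p * (u * u^-1 - 1)); last by ring.
      by rewrite ru subrr mulr0.
    have := upow_gt0 u_gt1 k; rewrite -subr_ge0.
    have -> : K - u ^ k - (p * (K - u ^ k * u) + (1 - p) * (K - u ^ k / u)) =
      u ^ k * (p * u + (1 - p) / u - 1) by ring.
    by move=> /ltW k0; rewrite mulr_ge0// subr_ge0.
  + have := mulr_ge0 q_ge0 (ltW (upow_gt0 u_gt1 (k - 1))); lra.
  + lra.
Qed.

Lemma lone_J_le_delay x tau : stopping_time X tau ->
  (forall w, tle (Some 1%N) (tau w)) ->
  (J P X i x tau (hit X set0) <= (disc 1 * K)%:E)%E.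
Proof.
move=> tau_stop tau1; apply: (J_le_supermartingale (theta := tau)
  (v := fun _ _ => disc 1 * K)).
- exact: (stopping_adapted_height x tau_stop).
- by move=> t k; rewrite mulr_ge0// ltW.
- move=> w; rewrite lone_payoff /reward; case e : (tau w) => [t|//].
  rewrite lee_fin ler_pM// ?put_ge0 ?put_le// hyperbolic_antitone//.
  by have := tau1 w; rewrite e /tle/= -leqNgt.
- by move=> t w _ _; rewrite -mulrDl addrC subrK mul1r.
Qed.

Lemma lone_Phi_below S x y : S y -> height x <= height y -> u ^ height y <= K ->
  Phi P X i set0 S x.
Proof.
move=> Sy; rewrite le_eqVlt => /predU1P[/height_inj -> _|xy yK]; first by left.
have [Sx|Sx] := pselect (S x); [by left|right; split=> //].
have xK : u ^ height x < K.
  by apply: lt_le_trans yK; rewrite ltNge le_upow// -ltNge.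
rewrite lone_J_stop; apply: (@le_lt_trans _ _ (disc 1 * (K - u ^ height x))%:E).
  by apply: V_le => tau *; exact: (lone_J_le_below (y := y)).
rewrite lte_fin; apply: lt_le_trans (put_ge _).
by rewrite gtr_pMl ?subr_gt0// hyperbolic1_lt1.
Qed.

(** Every delayed plan earns at most disc 1 * K, less than K - x for small x. *)
Lemma lone_Phi_contains_low_prices : exists j, below j `<=` Phi P X i set0 set0.
Proof.
have d1 : 0 < (1 - disc 1) * K by rewrite mulr_gt0// subr_gt0 hyperbolic1_lt1.
have [n un] := upow_small u_gt1 d1; exists (- n%:Z) => x xn; right; split=> //.
rewrite lone_J_stop; apply: (@le_lt_trans _ _ (disc 1 * K)%:E).
  by apply: V_le => tau *; exact: lone_J_le_delay.
rewrite lte_fin; apply: lt_le_trans (put_ge _).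
have : u ^ height x <= u ^ (- n%:Z) by rewrite le_upow.
move: un; lra.
Qed.

Lemma put_eventually0 k : exists n : nat, forall m : nat, (n <= m)%N ->
  put (k + m%:Z) = 0.
Proof.
have [n un] := upow_unbounded u_gt1 K; exists (n + absz k)%N => m nm.
apply/max_idPr; rewrite subr_le0; apply: (le_trans (ltW un)).
rewrite le_upow//; clear - nm; lia.
Qed.

(** The stopping set does not get stuck at a height k from which stopping at k + 1
    beats waiting for k. The new element is not k + 1 in general but a height at
    which the advantage of stopping over waiting is maximal; there the
    advantage, once delayed, cannot compensate for itself. *)
Lemma lone_Phi_progress k : A 0 1 * put k < put (k + 1) ->
  exists2 y, k < height y & Phi P X i set0 (below k) y.
Proof.
move=> stop_next; have [n put0] := put_eventually0 (k + 1).
(* The advantage of stopping at height k + 1 + m over waiting for k. It is not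
   positive for m >= n, so its maximum over m <= n bounds it at every height
   above k. *)
pose gain (m : 'I_n.+1) : R := put (k + 1 + m%:Z) - put k * A 0 (m%:Z + 1).
have gain0 : 0 < gain ord0.
  by rewrite /gain/= addr0 add0r subr_gt0 mulrC.
case: (@arg_maxP _ _ _ (ord0 : 'I_n.+1) xpredT gain isT) => m _ m_max.
pose D := gain m; have D0 : 0 < D by exact: lt_le_trans (m_max ord0 isT).
have dom j : k < j -> put j <= put k * A 0 (j - k) + D.
  move=> kj; have [l -> {kj}] : exists l : nat, j = k + 1 + l%:Z.
    by exists (absz (j - k - 1)%R); clear - kj; lia.
  rewrite (_ : k + 1 + l%:Z - k = l%:Z + 1); last by clear; lia.
  rewrite -lerBlDl; have [ln|nl] := ltnP l n.+1.
    exact: (m_max (Ordinal ln) isT).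
  rewrite put0; last exact: ltnW.
  by apply: le_trans (ltW D0); rewrite sub0r oppr_le0 mulr_ge0// put_ge0.
exists (at_height u (k + 1 + m%:Z)); rewrite ?at_heightK//.
  by clear; lia.
have above : k < height (at_height u (k + 1 + m%:Z)).
  by rewrite at_heightK//; clear; lia.
right; split; first by apply/negP; rewrite -ltNge.
rewrite lone_J_stop.
apply: (@le_lt_trans _ _ (put k * A 0 (k + 1 + m%:Z - k) + disc 1 * D)%:E).
  apply: V_le => tau *; rewrite -[X in A 0 (X - k)](at_heightK u_gt1).
  by apply: lone_J_le_barrier => //; exact: ltW.
rewrite at_heightK// lte_fin.
rewrite (_ : k + 1 + m%:Z - k = m%:Z + 1); last by clear; lia.
rewrite -ltrBrDl -/(gain m) -/D gtr_pMl//; exact: hyperbolic1_lt1.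
Qed.

(** Here j is the height of the threshold: waiting one step down is at least as
    good as stopping at the heights above j, and strictly worse at j and below. *)
Section optimal_threshold.
Context (j : int) (j_le : u ^ j <= K)
  (wait_above : forall k, j <= k -> put (k + 1) <= A 0 1 * put k)
  (stop_below : forall k, k < j -> A 0 1 * put k < put (k + 1)).

(** Waiting for one step down, repeatedly, is dominated by waiting for j directly
    because passage values are supermultiplicative. *)
Lemma put_dominated k : j < k -> put k <= put j * A 0 (k - j).
Proof.
move=> jk; have [n -> {jk}] : exists n : nat, k = j + n%:Z.
  by exists (absz (k - j)%R); clear - jk; lia.
rewrite (addrC j) addrK; elim: n => [|n IH].
  by rewrite add0r hit_value0 hyperbolic0 mulr1.
rewrite -addn1 PoszD -addrA (addrC 1) addrA.
apply: le_trans (wait_above _) _; first by clear; lia.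
apply: le_trans (ler_wpM2l (A_ge0 0 1) IH) _.
rewrite mulrCA ler_wpM2l ?put_ge0// mulrC.
exact: hit_value_step.
Qed.

(** From a height k + 1 > j, waiting for k is an admissible plan that is at least
    as good as stopping. *)
Lemma lone_iter_sub n : iter n (Phi P X i set0) set0 `<=` below j.
Proof.
elim: n => [x []|n IH x [/IH //|[_ VJ]]].
rewrite /below/= leNgt; apply/negP => jx; move: VJ; apply/negP; rewrite -leNgt.
pose k := height x - 1.
have xk : height x = k + 1 by rewrite subrK.
have jk : j <= k by rewrite /k; clear - jx; lia.
have kx : k < height x by rewrite /k; clear; lia.
rewrite lone_J_stop xk.
apply: (@le_trans _ _ (put k * A 0 (height x - k))%:E).
  have -> : height x - k = 1 by rewrite xk addrAC subrr add0r.
  by rewrite lee_fin mulrC; exact: wait_above.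
apply: le_trans (lone_J_continue_ge kx) (J_continue_le_V _ _ _).
by move=> y /IH yj; exact: le_trans yj jk.
Qed.

Lemma lone_Gamma : Gamma P X i set0 = below j.
Proof.
apply/seteqP; split; first by move=> x [n _]; exact: lone_iter_sub.
have [j1 low] := lone_Phi_contains_low_prices.
have fill n : j1 + n%:Z <= j ->
    exists m, below (j1 + n%:Z) `<=` iter m (Phi P X i set0) set0.
  elim: n => [|n IH] nj; first by exists 1%N; rewrite addr0.
  have [|m sub] := IH; first by clear - nj; lia.
  have [|y ky Py] := @lone_Phi_progress (j1 + n%:Z).
    by apply: stop_below; clear - nj; lia.
  have Sy : iter m.+1 (Phi P X i set0) set0 y by exact: Phi_monotone sub _ Py.
  exists m.+2 => x xn; apply: (lone_Phi_below Sy).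
    by move: xn; rewrite /below/=; clear - ky; lia.
  by apply: le_trans j_le; rewrite le_upow//; exact: lone_iter_sub Sy.
have [j1j|jj1] := leP j1 j; last first.
  move=> x xj; apply: (@iter_Phi_sub_Gamma _ 1%N); apply: low.
  exact: le_trans xj (ltW jj1).
have [|m sub] := fill (absz (j - j1)%R); first by clear - j1j; lia.
move=> x xj; apply: (@iter_Phi_sub_Gamma _ m); apply: sub.
by move: xj; rewrite /below/=; clear - j1j; lia.
Qed.

Lemma lone_optimal : optimal_intra_equilibrium P X i set0 (below j).
Proof.
have wait x : j < height x ->
    (J_stop P X i set0 x <= J_continue P X i set0 (below j) x)%E.
  move=> jx; rewrite lone_J_stop; apply: le_trans (lone_J_continue_ge jx).
  by rewrite lee_fin put_dominated.
have stop S' x : below j `<=` S' -> height x <= j ->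
    (J_continue P X i set0 S' x < J_stop P X i set0 x)%E.
  by rewrite -lone_Gamma => sub xj; apply: J_continue_lt_on_Gamma => //;
    rewrite lone_Gamma.
split.
  apply/seteqP; split=> x; first by case=> -[xj] //; rewrite ltNge wait// ltNge;
    exact/negP.
  by move=> xj; left; split=> //; apply/ltW/stop.
move=> S' S'eq x; have sub := Gamma_sub_equilibrium S'eq.
rewrite lone_Gamma in sub.
rewrite /U ge_max le_max lexx /=; have [xj|jx] := leP (height x) j.
  by rewrite le_max ltW ?stop.
rewrite le_max; apply/orP; right; apply: le_trans (lone_J_continue_ge jx).
rewrite -[X in X%:E]addr0 -(mulr0 (disc 1)); apply: lone_J_le_barrier => //.
- exact: stopping_hit_pos.
- by move=> w; exact: hit_pos_ge1.
- by move=> w; exact: hit_pos_antitone.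
- by move=> k jk; rewrite addr0 put_dominated.
Qed.

End optimal_threshold.

(** * A firm whose opponent concedes at low prices *)

Section waiting_for_surrender.
Context (j : int) (surrender : forall k, j < k -> put k <= N * A 0 (k - j)).
Local Notation T := (below j).

Let N_ge0 : 0 <= N. Proof. exact: le_trans (ltW K_gt0) K_le. Qed.

Definition surrender_value t k : R :=
  if k <= j then N * disc t else N * A t (k - j).

Lemma surrender_value_ge0 t k : 0 <= surrender_value t k.
Proof. by rewrite /surrender_value; case: ifP => _; rewrite mulr_ge0. Qed.

Lemma surrender_value_le t k : surrender_value t k <= N * disc t.
Proof.
by rewrite /surrender_value; case: ifP => // _; rewrite ler_wpM2l// hit_value_le.
Qed.

Lemma surrender_value_step t k : j < k -> surrender_value t k =
  p * surrender_value t.+1 (k + 1) + (1 - p) * surrender_value t.+1 (k - 1).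
Proof.
move=> jk; rewrite /surrender_value.
rewrite (_ : (k <= j) = false); last by clear - jk; lia.
rewrite (_ : (k + 1 <= j) = false); last by clear - jk; lia.
rewrite (hit_value_rec p_ge0 p_le1 b_gt0); last by clear - jk; lia.
rewrite (_ : k + 1 - j = k - j + 1); last by clear; lia.
case: ifP => kj; last first.
  by rewrite (_ : k - 1 - j = k - j - 1); [ring|clear; lia].
rewrite (_ : k - j - 1 = 0); last by clear - jk kj; lia.
by rewrite hit_value0; ring.
Qed.

Lemma put_le_surrender t k : disc t * put k <= surrender_value t k.
Proof.
rewrite /surrender_value; case: (leP k j) => jk.
  by rewrite mulrC ler_wpM2r// (le_trans (put_le k)).
apply: le_trans (ler_wpM2l (disc_ge0 t) (surrender jk)) _.
by rewrite mulrCA ler_wpM2l// hit_value_delay.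
Qed.

Let before_hit w t : tlt (Some t) (hit X T w) -> j < height (X t w).
Proof. by move=> /before_first_time nT; rewrite ltNge; apply/negP. Qed.

(** Waiting for the concession dominates every stopping time: a tie is worth at
    most N, and stopping first at time t is worth at most
    disc t * N * A(0, k - j) <= N * A(t, k - j). *)
Lemma J_le_surrender x tau : stopping_time X tau ->
  (J P X i x tau (hit X T) <= (surrender_value 0 (height x))%:E)%E.
Proof.
move=> tau_stop; pose theta w := emin (tau w) (hit X T w).
apply: (J_le_supermartingale (theta := theta)).
- apply: adapted_emin; first exact: (stopping_adapted_height x tau_stop).
  by apply: (stopping_adapted_height x); exact: stopping_hit.
- exact: surrender_value_ge0.
- move=> w; have := first_time_spec [set t | T (X t w)].
  rewrite /payoff /reward /theta /emin /tle -/(hit X T w).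
  case: (tau w) => [t|]; case: hit => [s|] hit_spec /=.
  + have [Ts _] := hit_spec; case: (ltngtP t s) => [ts|st|ts] /=.
    * by rewrite lee_fin heightE; exact: put_le_surrender.
    * by rewrite lee_fin /surrender_value (Ts : height _ <= j) mulrC.
    * rewrite ts lee_fin /surrender_value (Ts : height _ <= j) mulrC ler_wpM2r//.
      by case/andP: (h_bounds (X s w)).
  + by rewrite lee_fin heightE; exact: put_le_surrender.
  + case: hit_spec => Ts _.
    by rewrite lee_fin /surrender_value (Ts : height _ <= j) mulrC.
  + by rewrite vanishing_tie.
- move=> t w _; rewrite tlt_emin => /andP[_ /before_hit jt].
  by rewrite -surrender_value_step.
Qed.

Lemma J_continue_ge_surrender x :
  ((surrender_value 0 (height x))%:E <= J_continue P X i T set0 x)%E.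
Proof.
apply: (J_ge_submartingale (theta := hit X T) (c := N)).
- by apply: (stopping_adapted_height x); exact: stopping_hit.
- by move=> t k; rewrite surrender_value_ge0 surrender_value_le.
- move=> w; have := first_time_spec [set t | T (X t w)].
  have := first_time_spec [set t | (0 < t)%N /\ set0 (X t w)].
  rewrite /payoff /reward -/(hit X T w) -/(hit_pos X set0 w).
  case: hit_pos => [t [[]]//|_]; case: hit => [s [Ts _]|_].
    by rewrite lee_fin /surrender_value (Ts : height _ <= j) mulrC.
  by rewrite vanishing_tie.
- by move=> t w _ /before_hit jt; rewrite -surrender_value_step.
Qed.

Let J_le_continue x tau : stopping_time X tau ->
  (J P X i x tau (hit X T) <= J_continue P X i T set0 x)%E.
Proof.
move=> tau_stop.
exact: le_trans (J_le_surrender x tau_stop) (J_continue_ge_surrender x).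
Qed.

Let J_stop_le_continue x : (J_stop P X i T x <= J_continue P X i T set0 x)%E.
Proof.
apply: J_le_continue.
rewrite (_ : (fun=> Some 0%N) =
  fun w => first_time [set t | true /\ setT (X t w)]).
  exact: (stopping_first_time xpredT).
apply/funext => w; have := first_time_spec [set t | true /\ setT (X t w)].
case: first_time => [t [_ /(_ 0%N (conj isT I))]|/(_ 0%N (conj isT I))//].
by rewrite leqn0 => /eqP ->.
Qed.

Lemma surrender_Gamma : Gamma P X i T = set0.
Proof.
have Phi0 : Phi P X i T set0 = set0.
  apply/seteqP; split=> // x [//|[_]]; apply/negP; rewrite -leNgt.
  exact: le_trans (J_stop_le_continue x) (J_continue_le_V _ _ _).
apply/seteqP; split=> // x [n _].
suff -> : iter n.+1 (Phi P X i T) set0 = set0 by [].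
by elim: n => [|n IH]; rewrite iterS ?IH Phi0.
Qed.

Lemma surrender_optimal : optimal_intra_equilibrium P X i T set0.
Proof.
split.
  apply/seteqP; split=> // x [[]//|[_]]; apply/negP; rewrite -leNgt.
  exact: J_stop_le_continue.
move=> S' _ x; rewrite /U [leRHS]max_r// ge_max J_stop_le_continue/=.
by apply: J_le_continue; exact: stopping_hit_pos.
Qed.

End waiting_for_surrender.
End one_firm.

(** * The threshold *)

Section stopping_threshold.
Context (R : realType) (u p b K : R) (u_gt1 : 1 < u) (p_gt0 : 0 < p)
  (p_lt1 : p < 1) (b_gt0 : 0 < b) (K_gt0 : 0 < K).

(** Before the passage to 0 the process A(t, Y_t) is a martingale, and it equals
    the discount factor at the passage. *)
Lemma alpha_hit_value (d : measure_display) (Omega : measurableType d)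
    (Q : probability Omega R) (Y : nat -> Omega -> int) :
  markov_chain (walk_step p) Q Y -> (0 < Q [set w | Y 0%N w = 1%R])%E ->
  alpha Q Y b = hit_value p b 0 1.
Proof.
move=> walk start; have p0 := ltW p_gt0; have p1 := ltW p_lt1.
set D := [set w | Y 0%N w = 1] in start *.
have A0 t k : 0 <= hit_value p b t k by exact: hit_value_ge0.
have A1 t k : hit_value p b t k <= hyperbolic b t by exact: hit_value_le.
have hit_adapted : adapted Y (hit Y [set 0]).
  apply: (stopping_adapted (code := id) (@inj_id int) walk).
  exact: stopping_hit.
have not_hit w t : tlt (Some t) (hit Y [set 0] w) -> Y t w != 0.
  by move=> /before_first_time not0; exact/eqP.
have int_reward : (\int[Q]_(w in D) reward Y (hit Y [set 0]%R) (hit_value p b) w =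
    (hit_value p b 0 1)%:E * Q D)%E.
  apply: le_anti; apply/andP; split.
    apply: (reward_le_supermartingale p0 p1 walk hit_adapted A0) => t w _ /not_hit Yt.
    by rewrite -hit_value_rec.
  apply: (reward_ge_submartingale p0 p1 walk hit_adapted A0 (hyperbolic_cvg0 b_gt0) A1).
  by move=> t w _ /not_hit Yt; rewrite -hit_value_rec.
have QD_fin : Q D \is a fin_num.
  by apply: fin_num_measure; exact: (walk.1 0%N [set 1]).
rewrite /alpha -/D; under eq_integral => w _.
  rewrite (_ : _%:E = reward Y (hit Y [set 0]) (hit_value p b) w); first over.
  have := first_time_spec [set t | [set 0] (Y t w)].
  rewrite /reward -/(hit Y [set 0] w); case: hit => [t [/= -> _]|//].
  by rewrite hit_value0.
rewrite int_reward fineM//= mulfK// gt_eqF// fine_gt0// start/=.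
by rewrite ltey_eq QD_fin.
Qed.

Local Notation a := (hit_value p b 0 1).
Local Notation c := ((1 - a) / (u - a) * K).

Let a_ge0 : 0 <= a. Proof. by apply: hit_value_ge0 => //; exact: ltW. Qed.
Let a_lt1 : a < 1. Proof. by apply: hit_value_lt1 => //; exact: ltW. Qed.
Let ua_gt0 : 0 < u - a. Proof. by rewrite subr_gt0 (lt_trans a_lt1). Qed.

Lemma threshold_gt0 : 0 < c.
Proof. by rewrite mulr_gt0// divr_gt0// subr_gt0. Qed.

Let c_eq : (u - a) * c = (1 - a) * K.
Proof. by rewrite mulrA mulrCA divff ?gt_eqF// mulr1. Qed.

(** The least power of u that is at least c is below u * c, so the threshold price
    does not exceed K. *)
Lemma threshold_lt_strike : u * c <= K.
Proof.
rewrite -(ler_pM2l ua_gt0) mulrCA c_eq mulrA (ler_wpM2r (ltW K_gt0))//.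
have : 0 <= a * (u - 1) by rewrite mulr_ge0// subr_ge0 ltW.
lra.
Qed.

(** The inequality K - u x <= a (K - x) means c <= x. *)
Lemma wait_above_threshold k : c <= u ^ k ->
  put u K (k + 1) <= a * put u K k.
Proof.
move=> ck; rewrite ge_max mulr_ge0 ?put_ge0// andbT.
apply: le_trans (ler_wpM2l a_ge0 (put_ge u K k)).
have := ler_wpM2l (ltW ua_gt0) ck; rewrite c_eq upowS//; lra.
Qed.

Lemma stop_below_threshold k : u ^ k < c -> a * put u K k < put u K (k + 1).
Proof.
move=> kc; have c_le : c <= K.
  apply: le_trans threshold_lt_strike.
  by rewrite ler_peMl// ltW// threshold_gt0.
rewrite putE; last exact: ltW (lt_le_trans kc c_le).
apply: lt_le_trans (put_ge _ _ _).
have := kc; rewrite -(ltr_pM2l ua_gt0) c_eq upowS//; lra.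
Qed.

End stopping_threshold.

Theorem proposition5p1 (R : realType) (u p : R)
    (u_gt1 : 1 < u) (p_gt0 : 0 < p) (p_lt1 : p < 1) (p_ge : (u + 1)^-1 <= p)
    (d : measure_display) (Omega : measurableType d)
    (P : state u -> probability Omega R) (X : nat -> Omega -> state u)
    (X_markov : markov_family (@state_step R u p) P X)
    (d' : measure_display) (Omega' : measurableType d')
    (Q : probability Omega' R) (Y : nat -> Omega' -> int)
    (Y_walk : markov_chain (walk_step p) Q Y)
    (Y_start : (0 < Q [set w | Y 0%N w = 1%R])%E)
    (r N : R) (r_gt0 : 0 < r) (N_gt : r / 2 < N) (N_lt : N < r)
    (K : R) (K_def : K = r - N)
    (beta1 beta2 : R) (beta1_gt0 : 0 < beta1) (beta2_gt0 : 0 < beta2)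
    (h1 h2 : state u -> R)
    (h1_bounds : forall x, Num.max (K - set_val x) 0 <= h1 x <= N)
    (h2_bounds : forall x, Num.max (K - set_val x) 0 <= h2 x <= N)
    (beta_le : beta1 <= beta2) :
  let firm1 := firm K N beta1 h1 in
  let firm2 := firm K N beta2 h2 in
  let S := S_iter P X firm1 firm2 in
  let T := T_iter P X firm1 firm2 in
  let S_lim := \bigcup_n S n in
  let T_lim := \bigcap_n T n in
  let ystar2 := threshold u K (alpha Q Y beta2) in
  (forall n, S n = S 0%N /\ T n = T 0%N) /\
  (S_lim, T_lim) = (S 0%N, T 0%N) /\
  (S 0%N, T 0%N) = (set0, [set x : state u | 0 < set_val x <= ystar2]) /\
  sharp_equilibrium P X firm1 firm2 (S_lim, T_lim).
Proof.
move=> firm1 firm2 S T S_lim T_lim ystar2.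
have K_gt0 : 0 < K by rewrite K_def subr_gt0.
have K_le : K <= N by rewrite K_def; lra.
have a_val : alpha Q Y beta2 = hit_value p beta2 0 1 by exact: alpha_hit_value.
have [j [yj cj below_c]] : exists j : int, [/\ ystar2 = u ^ j,
    (1 - hit_value p beta2 0 1) / (u - hit_value p beta2 0 1) * K <= u ^ j &
    forall k, k < j ->
      u ^ k < (1 - hit_value p beta2 0 1) / (u - hit_value p beta2 0 1) * K].
  by rewrite /ystar2 a_val; apply: thresholdE => //; exact: threshold_gt0.
have uj_le : u ^ j <= K.
  have j1 : j - 1 < j by rewrite gtrBl.
  have /ltW := below_c _ j1.
  rewrite upow_pred// ler_pdivrMr ?(lt_trans _ u_gt1)// => /le_trans; apply.
  by rewrite mulrC threshold_lt_strike.
have wait k : j <= k -> put u K (k + 1) <= hit_value p beta2 0 1 * put u K k.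
  move=> jk; apply: wait_above_threshold => //; apply: le_trans cj _.
  by rewrite le_upow.
have stop k : k < j -> hit_value p beta2 0 1 * put u K k < put u K (k + 1).
  by move=> kj; apply: stop_below_threshold => //; exact: below_c.
have T0 : Gamma P X firm2 set0 = below j.
  exact: (lone_Gamma u_gt1 p_gt0 p_lt1 p_ge X_markov
    K_gt0 K_le beta2_gt0 h2_bounds uj_le wait stop).
have surrender k : j < k -> put u K k <= N * hit_value p beta1 0 (k - j).
  move=> jk; apply: (@le_trans _ _ (put u K j * hit_value p beta2 0 (k - j))).
    by apply: put_dominated => //; exact: ltW.
  apply: ler_pM; [exact: put_ge0| |exact: le_trans (put_le _ _ _) K_le|].
    by apply: hit_value_ge0 => //; exact: ltW.
  by apply: hit_value_le_rate => //; exact: ltW.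
have S1 : Gamma P X firm1 (below j) = set0.
  exact: (surrender_Gamma u_gt1 p_gt0 p_lt1 X_markov
    K_gt0 K_le beta1_gt0 h1_bounds surrender).
have Sn n : S n = set0.
  by elim: n => [//|n IH]; rewrite /S/= -/(S n) IH T0 S1.
have Tn n : T n = below j by rewrite /T/T_iter -/(S n) Sn T0.
have S_limE : S_lim = set0.
  by apply/seteqP; split=> // x [n _]; rewrite Sn.
have T_limE : T_lim = below j.
  by apply/seteqP; split=> x; [move=> /(_ 0%N I); rewrite Tn|move=> xj n _; rewrite Tn].
split; first by move=> n; rewrite !Sn !Tn.
split; first by rewrite S_limE T_limE Sn Tn.
split.
  rewrite Sn Tn; congr pair; apply/seteqP; split=> x.
    by rewrite /below/= heightE yj le_upow// upow_gt0.
  by rewrite /below/= heightE yj le_upow// => /andP[].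
rewrite S_limE T_limE; split=> /=.
  exact: (surrender_optimal u_gt1 p_gt0 p_lt1 X_markov
    K_gt0 K_le beta1_gt0 h1_bounds surrender).
exact: (lone_optimal u_gt1 p_gt0 p_lt1 p_ge X_markov
  K_gt0 K_le beta2_gt0 h2_bounds uj_le wait stop).
Qed.
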